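(* Let $m$ be a positive integer, let $h(t)$ be an impulse response with the interpolation property, and let $\rho^m_d[n]$ be a proper discrete-time signal that vanishes for all $n\le 0$ and all $n\ge m+1$. If $\rho^m\in\chi^m(\rho^m_d)$ denotes the optimum basis spline for which $\widehat{\rho^m}$ best approximates $h$, i.e. $$\rho^m=\underset{y\in\chi^m(\rho^m_d)}{\operatorname{arg\,min}}\ \lVert h-\widehat y\rVert_2,$$ then $\rho^m$ satisfies, for all $t\in(0,m+1)$, $$\Big(\big[(\rho^m_p)^{-1}*(\overline{\rho^m_p})^{-1}\big]*\rho^m\Big)(t)=\Big((\overline{\rho^m_p})^{-1}*h\Big)(t).$$
   Context: Signals are complex-valued functions; $*$ between signals denotes convolution, $z^*$ denotes the complex conjugate, and $\overline{y}(t):=y^*(-t)$. $\lVert\cdot\rVert_2$ is the $L^2(\mathbb R)$ norm. Samples: for a continuous-time signal $y(t)$ (sampling period $1$), $y_d[n]:=y(n)$ for $n\in\mathbb Z$ and $y_p(t):=\sum_{n\in\mathbb Z}y_d[n]\,\delta(t-n)$. Thus $y_p$ is an impulse train encoding $y_d$, and convolving a function $g$ with it gives $(y_p*g)(t)=\sum_n y_d[n]g(t-n)$. Similarly, $\rho^m_p(t):=\sum_n\rho^m_d[n]\delta(t-n)$. Interpolation property: $h$ has the interpolation property if $h_p(t)=\delta(t)$, i.e. $h(0)=1$ and $h(n)=0$ for all nonzero integers $n$. Proper signal: a discrete-time signal $y_d[n]$ is proper if it is bounded and has a unique and bounded convolution inverse $y_d^{-1}[n]$ (i.e. $(y_d*y_d^{-1})[n]$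 equals $1$ for $n=0$ and $0$ otherwise). Then $(y_p)^{-1}(t):=\sum_n y_d^{-1}[n]\delta(t-n)$, so $(y_p)^{-1}*y_p=\delta$. If $y_d$ is proper, $\widehat y(t):=((y_p)^{-1}*y)(t)=\sum_n y_d^{-1}[n]\,y(t-n)$. The class $D$: all continuous-time signals $y$ that have finitely many extrema in any given interval, have finitely many discontinuities in any given interval, are absolutely integrable over a period (for the compactly supported functions considered here: over their support), and are bounded. The set $\chi^m(\rho^m_d)$: all continuous-time signals $y$ with (1) $y\in D$; (2) $y(n)=\rho^m_d[n]$ for all $n\in\mathbb N$; (3) $y(t)=0$ for all $t\notin(0,m+1)$.
   Formalization: The identity is stated for almost every t in (0,m+1), and at every integer t or t where both sides are continuous, not for all t; h is assumed to be in L^2; the inverse is unique among bounded signals; extrema are strict ones of real and imaginary parts. *)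

(* Defs.v *)
From HB Require Import structures.
From mathcomp Require Import all_boot all_order all_algebra.
From mathcomp Require Export complex.
From mathcomp Require Export all_classical all_reals all_analysis.

Set Implicit Arguments.
Unset Strict Implicit.
Unset Printing Implicit Defensive.

Import Order.TTheory GRing.Theory Num.Theory.
Import numFieldNormedType.Exports.
Local Open Scope classical_set_scope.
Local Open Scope ring_scope.

(* Signals take values in R[i]; R[i]^o is R[i] with the topology of its modulus. *)
Section Signals.
Variable R : realType.
Local Notation C := (R[i]).
Local Notation normc := (@ComplexField.Normc.normc R).
Local Notation mu := (@lebesgue_measure R).

Implicit Types (a b : int -> C) (y g : R -> C).

(* Two-sided series are summed along the symmetric partial sums. *)
Definition zpartial a (N : nat) : C^o :=
  \sum_(k < N.*2.+1) a (k%:Z - N%:Z).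

Definition zsum a : C := limn (zpartial a).

Definition ddelta (n : int) : C := (n == 0)%:R.

Definition dbounded a : Prop := exists M : R, forall n, normc (a n) <= M.

Definition dconv a b (n : int) : C := zsum (fun k => a k * b (n - k)).

(* b is a convolution inverse of a; the series are required to converge. *)
Definition dinverse a b : Prop :=
  forall n, zpartial (fun k => a k * b (n - k)) @ \oo --> (ddelta n : C^o).

(* Uniqueness is among bounded sequences: a finitely supported a having at
   least two nonzero terms always has several unbounded inverses. *)
Definition proper_signal a : Prop :=
  dbounded a /\ exists! b, dbounded b /\ dinverse a b.

(* The bounded convolution inverse; only meaningful if a is proper. *)
Definition conv_inv a : int -> C :=
  xget (fun=> 0) [set b | dbounded b /\ dinverse a b].

(* An impulse train \sum_n a n * delta (t - n) is represented by the sequence a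
   of its weights.  Under this encoding conv_inv is also the convolution inverse
   of impulse trains, dconv is their convolution, and drev is the operation
   y |-> (t |-> (y (- t))^* ) on impulse trains. *)
Definition drev a (n : int) : C := (a (- n))^*%C.

Definition pconv a g (t : R) : C := zsum (fun n => a n * g (t - n%:~R)).

Definition samples y (n : int) : C := y n%:~R.

Definition interpolation y : Prop := samples y = ddelta.

Definition yhat y : R -> C := pconv (conv_inv (samples y)) y.

Definition L2norm y : \bar R := ('N[mu]_2%:E[(fun t => (normc (y t))%:E)])%E.

Definition in_L2 y : Prop :=
  [/\ measurable_fun setT (fun t => complex.Re (y t)),
      measurable_fun setT (fun t => complex.Im (y t)) &
      (L2norm y < +oo)%E].

(* Strict, because a non-strict reading would turn every point of an interval
   on which f is constant (e.g. outside of its support) into an extremum. *)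
Definition strict_extremum (f : R -> R) (x : R) : Prop :=
  (\forall z \near x^', f z < f x) \/ (\forall z \near x^', f x < f z).

(* The extrema of a complex signal are those of its real and imaginary parts.
   For a compactly supported signal, integrability on R is integrability on
   its support. *)
Definition class_D y : Prop :=
  [/\ forall u v : R, finite_set [set x | u <= x <= v /\
        (strict_extremum (fun t => complex.Re (y t)) x \/
         strict_extremum (fun t => complex.Im (y t)) x)],
      forall u v : R, finite_set [set x | u <= x <= v /\
        ~ {for x, continuous (y : R -> C^o)}],
      mu.-integrable setT (fun t => (complex.Re (y t))%:E) /\
        mu.-integrable setT (fun t => (complex.Im (y t))%:E) &
      exists M : R, forall t, normc (y t) <= M].

Definition chi (m : nat) (rho_d : int -> C) : set (R -> C) :=
  [set y | [/\ class_D y,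
               forall n : nat, y n%:R = rho_d n%:Z &
               forall t, ~ (0 < t < m.+1%:R) -> y t = 0]].

(* Minimisers are not unique as functions: L2norm ignores null sets. *)
Definition is_argmin (T : Type) (A : set T) (F : T -> \bar R) (x : T) : Prop :=
  A x /\ forall z, A z -> (F x <= F z)%E.

End Signals.

(* Main.v *)
(** Write [b] for the bounded inverse of [rho_d] and [r] for the residual
    [h - yhat rho]; for signals [y] of [chi], [yhat y = pconv b y].

    Uniqueness of the bounded inverse forbids zeros of the symbol
    [\sum_k rho_d k * z ^ k] on the unit circle, and this makes [b] absolutely
    summable.  Let [A] be the interval (0, x) with its integers removed.  Adding to
    [rho] a multiple of the indicator [1_A] keeps it in [chi], so minimality makes
    [r] orthogonal to [pconv b 1_A] in L^2.  Translating each term of the inner product gives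
      \int_A (\sum_n conj (b (- n)) * r (t - n)) dt = 0   for all x <= m + 1,
    so by Lebesgue differentiation [\sum_n drev b n * r (t - n)] vanishes for almost
    every [t] in (0, m + 1).  Since [drev b] is the inverse of [drev rho_d], this
    is the asserted identity.  On the integers [r] is zero because [h] and
    [yhat rho] both interpolate the unit impulse, and at points of continuity
    the equality extends from a set of full measure. *)

Require Import Defs.
From HB Require Import structures.
From mathcomp Require Import all_boot all_order all_algebra.
From mathcomp Require Import complex.
From mathcomp Require Import all_classical all_reals all_analysis.
From mathcomp Require Import measurable_realfun.
From mathcomp Require Import ring lra zify.
Import Order.TTheory GRing.Theory Num.Theory.
Import numFieldNormedType.Exports.
Import ComplexField.Normc.
Local Open Scope classical_set_scope.
Local Open Scope ring_scope.

Set Implicit Arguments.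
Unset Strict Implicit.

(** Absolute summability of [b] is what legitimises the formal computation. Symmetric partial sums
    are not invariant under translation of the index, so even commutativity of the convolution of
    two sequences needs it; it makes [pconv b g] square integrable for bounded, integrable [g]
    supported in [0, m + 1]; and it makes the series of translates of [r] converge almost
    everywhere. As [h] is only in L^2, convergence of that series at every point cannot be expected,
    so the identity comes out almost everywhere first. The left-hand side is never handled as a
    double series. Since [rho] vanishes outside an interval of length [m + 1], at most [m + 1] terms
    of each sum over its translates are nonzero, and regrouping amounts to taking a finite
    combination of limits. Orthogonality is kept as a family of real identities, the real part of
    the inner product times an arbitrary complex weight [w]. The weights 1 and -i recover the
    complex statement at the end, and the differentiation theorem is applied to real functions
    only. *)

Local Notation normc := (@ComplexField.Normc.normc _).

(** * Complex moduli and limits *)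

Section Modulus.
Variable R : realType.
Local Notation C := R[i].
Implicit Types x y : C.

Lemma normc_normE x : `|x| = (normc x)%:C%C.
Proof. by []. Qed.

Lemma normc_ge0 x : 0 <= normc x.
Proof. by rewrite -(@ler0c R) -normc_normE normr_ge0. Qed.

Lemma ler_normcD x y : normc (x + y) <= normc x + normc y.
Proof. exact: le_normcD. Qed.

Lemma normc_opp x : normc (- x) = normc x.
Proof. exact: normcN. Qed.

Lemma normc_dist x y : normc (x - y) = normc (y - x).
Proof. by rewrite -normc_opp opprB. Qed.

Lemma normc_conj x : normc x^*%C = normc x.
Proof. by apply: complexI; rewrite -!normc_normE normcJ. Qed.

Lemma normc_sqr x : normc x ^+ 2 = complex.Re x ^+ 2 + complex.Im x ^+ 2.
Proof.
by case: x => a b /=; rewrite sqr_sqrtr// addr_ge0// sqr_ge0.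
Qed.

Lemma normc_real (r : R) : normc r%:C%C = `|r|.
Proof. by rewrite /= expr0n addr0 sqrtr_sqr. Qed.

Lemma ler_Re_normc x : `|complex.Re x| <= normc x.
Proof.
by case: x => a b /=; rewrite -sqrtr_sqr ler_wsqrtr// lerDl sqr_ge0.
Qed.

Lemma ler_Im_normc x : `|complex.Im x| <= normc x.
Proof.
by case: x => a b /=; rewrite -sqrtr_sqr ler_wsqrtr// lerDr sqr_ge0.
Qed.

Lemma ler_normc_ReIm x : normc x <= `|complex.Re x| + `|complex.Im x|.
Proof.
rewrite -(@ler_pXn2r _ 2) ?nnegrE ?normc_ge0 ?addr_ge0// normc_sqr sqrrD.
by rewrite !real_normK ?num_real// lerD2r lerDl mulrn_wge0// mulr_ge0.
Qed.

Lemma ler_normc_sum (I : Type) (s : seq I) (P : pred I) (F : I -> C) :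
  normc (\sum_(i <- s | P i) F i) <= \sum_(i <- s | P i) normc (F i).
Proof.
elim/big_rec2: _ => [|i y1 y2 _ le_y]; first by rewrite normc0.
by rewrite (le_trans (ler_normcD _ _))// lerD2l.
Qed.

Lemma Re_add x y : complex.Re (x + y) = complex.Re x + complex.Re y.
Proof. by case: x y => ? ? []. Qed.

Lemma Im_add x y : complex.Im (x + y) = complex.Im x + complex.Im y.
Proof. by case: x y => ? ? []. Qed.

Lemma Re_opp x : complex.Re (- x) = - complex.Re x.
Proof. by case: x. Qed.

Lemma Im_opp x : complex.Im (- x) = - complex.Im x.
Proof. by case: x. Qed.

Lemma Re_mul x y : complex.Re (x * y) =
  complex.Re x * complex.Re y - complex.Im x * complex.Im y.
Proof. by case: x y => ? ? []. Qed.

Lemma Im_mul x y : complex.Im (x * y) =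
  complex.Re x * complex.Im y + complex.Im x * complex.Re y.
Proof. by case: x y => ? ? [? ?] /=; rewrite addrC. Qed.

Lemma Re_conjc x : complex.Re x^*%C = complex.Re x. Proof. by case: x. Qed.

Lemma Im_conjc x : complex.Im x^*%C = - complex.Im x. Proof. by case: x. Qed.

(** The norm of [C^o] takes values in [C], so the epsilon of its limits is a complex number. A
    positive complex number has zero imaginary part, hence real epsilons suffice and limits can be
    estimated with the real-valued [normc]. *)
Lemma cvg_normcP (T : Type) (F : set_system T) {FF : Filter F}
    (f : T -> C^o) (l : C^o) :
  f @ F --> l <-> (normc (f t - l) : R) @[t --> F] --> (0 : R).
Proof.
split => [/cvgrPdist_lt fl|/cvgrPdist_lt fl]; apply/cvgrPdist_lt => e e0.
  have /fl : (0 : C) < e%:C%C by rewrite ltcR.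
  apply: filterS => t; rewrite distrC normc_normE ltcR sub0r normrN.
  by rewrite ger0_norm// normc_ge0.
have /andP[/eqP Ime Ree] : (complex.Im e == 0) && (0 < complex.Re e).
  by move: e0; rewrite ltcE.
have /fl := Ree; apply: filterS => t; rewrite sub0r normrN => H.
rewrite distrC normc_normE ltcE/= Ime eqxx /=.
by apply: le_lt_trans H; rewrite ler_norm.
Qed.

Lemma cvgC_ReIm (T : Type) (F : set_system T) {FF : Filter F}
    (f : T -> C^o) (l : C^o) :
  f @ F --> l <-> (complex.Re (f t) @[t --> F] --> complex.Re l /\
                   complex.Im (f t) @[t --> F] --> complex.Im l).
Proof.
split => [/cvg_normcP fl|[/cvgrPdist_lt fR /cvgrPdist_lt fI]].
  split; apply/cvgrPdist_lt => e e0;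
    move/cvgrPdist_lt: fl => /(_ _ e0); apply: filterS => t;
    rewrite sub0r normrN ger0_norm ?normc_ge0// distrC; apply: le_lt_trans.
  - by rewrite -Re_opp -Re_add ler_Re_normc.
  - by rewrite -Im_opp -Im_add ler_Im_normc.
apply/cvg_normcP/cvgrPdist_lt => e e0.
have e20 : 0 < e / 2 by rewrite divr_gt0.
near=> t; rewrite sub0r normrN ger0_norm ?normc_ge0//.
rewrite (le_lt_trans (ler_normc_ReIm _))// Re_add Re_opp Im_add Im_opp (splitr e).
by rewrite ltrD// distrC; near: t; [exact: fR|exact: fI].
Unshelve. all: by end_near. Qed.

Lemma cvgC_perturb (T : Type) (F : set_system T) {FF : Filter F}
    (f g : T -> C^o) (l : C^o) :
  f @ F --> l -> (normc ((g t : C) - f t) : R) @[t --> F] --> (0 : R) ->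
  g @ F --> l.
Proof.
move=> /cvg_normcP fl gf; apply/cvg_normcP.
have := cvgD gf fl; rewrite addr0 => /(_ FF) gl; apply: squeeze_cvgr (cvg_cst 0) gl.
apply: nearW => t; rewrite normc_ge0 /=.
by rewrite -[X in normc X <= _](subrKA (f t : C)) ler_normcD.
Qed.

End Modulus.

(** * Symmetric partial sums *)

Section SymmetricSums.

Definition symsum (V : zmodType) (a : int -> V) (N : nat) : V :=
  \sum_(k < N.*2.+1) a (k%:Z - N%:Z).

Lemma eq_symsum (V : zmodType) (a b : int -> V) : a =1 b -> symsum a =1 symsum b.
Proof. by move=> ab N; apply: eq_bigr => k _. Qed.

Lemma symsum0 (V : zmodType) (a : int -> V) : symsum a 0 = a 0.
Proof. by rewrite /symsum big_ord_recl big_ord0 addr0. Qed.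

Lemma symsumS (V : zmodType) (a : int -> V) N :
  symsum a N.+1 = symsum a N + (a N.+1%:Z + a (- N.+1%:Z)).
Proof.
rewrite /symsum doubleS big_ord_recr big_ord_recl/= sub0r -addrA addrCA.
congr (_ + _); first by apply: eq_bigr => k _; congr a; rewrite /bump/=; lia.
by rewrite addrC; congr (a _ + _); lia.
Qed.

Lemma symsum_oppr (V : zmodType) (a : int -> V) :
  symsum (fun k => a (- k)) =1 symsum a.
Proof.
elim=> [|N IH]; first by rewrite !symsum0 oppr0.
by rewrite !symsumS IH opprK [a (- _) + _]addrC.
Qed.

(** Only the two end terms of the window change; translations of the index therefore preserve limits
    as soon as the terms tend to 0. *)
Lemma symsum_succ (V : zmodType) (a : int -> V) N :
  symsum (fun k => a (k + 1)) N = symsum a N + (a N.+1%:Z - a (- N%:Z)).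
Proof.
elim: N => [|N IH].
  by rewrite !symsum0 oppr0 add0r [RHS]addrC subrK.
rewrite !symsumS IH.
have -> : N.+1%:Z + 1 = N.+2%:Z by lia.
have -> : - N.+1%:Z + 1 = - N%:Z by lia.
move: (a _) (a (- N%:Z)) (a (- N.+1%:Z)) (a N.+2%:Z) => p q s u.
rewrite -!addrA; congr (_ + _).
by rewrite [u + q]addrC addKr [u - s]addrC addNKr.
Qed.

Lemma symsumD (V : zmodType) (a b : int -> V) N :
  symsum (fun k => a k + b k) N = symsum a N + symsum b N.
Proof. exact: big_split. Qed.

Lemma symsumMl (V : pzRingType) (x : V) (a : int -> V) N :
  symsum (fun k => x * a k) N = x * symsum a N.
Proof. by rewrite /symsum mulr_sumr. Qed.

Lemma symsumMr (V : pzRingType) (x : V) (a : int -> V) N :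
  symsum (fun k => a k * x) N = symsum a N * x.
Proof. by rewrite /symsum mulr_suml. Qed.

Lemma symsum_morph (U V : zmodType) (f : U -> V) (a : int -> U) N :
  f 0 = 0 -> {morph f : x y / x + y} ->
  f (symsum a N) = symsum (f \o a) N.
Proof. by move=> f0 fD; rewrite /symsum (big_morph f fD f0). Qed.

Lemma symsum_fin (V : zmodType) (a : int -> V) (m N : nat) :
  (forall k, ~~ (0 <= k <= m%:Z) -> a k = 0) -> (m <= N)%N ->
  symsum a N = \sum_(j < m.+1) a j%:Z.
Proof.
move=> a0 mN.
have -> : symsum a N = \sum_(j < N.+1) a j%:Z.
  elim: N {mN} => [|N IH]; first by rewrite symsum0 big_ord_recl big_ord0 addr0.
  by rewrite symsumS IH [RHS]big_ord_recr/= [a (- _)]a0 ?addr0//; lia.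
rewrite -(subnKC mN) -addSn big_split_ord/= [X in _ + X]big1 ?addr0// => i _.
by rewrite a0//; lia.
Qed.

Lemma ler_symsum (R : numDomainType) (a b : int -> R) N :
  (forall k, a k <= b k) -> symsum a N <= symsum b N.
Proof. by move=> ab; apply: ler_sum => k _. Qed.

Lemma symsum_ge0 (R : numDomainType) (a : int -> R) N :
  (forall k, 0 <= a k) -> 0 <= symsum a N.
Proof. by move=> a0; apply: sumr_ge0 => k _. Qed.

Lemma nondecreasing_symsum (R : realType) (a : int -> R) :
  (forall k, 0 <= a k) -> nondecreasing_seq (symsum a).
Proof.
move=> a0; apply/nondecreasing_seqP => N.
by rewrite symsumS lerDl addr_ge0.
Qed.

End SymmetricSums.

(** * Absolutely summable two-sided sequences *)

Section Summable.
Variable R : realType.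
Local Notation C := R[i].
Implicit Types (a b c d : int -> C) (p : {poly C}).

Lemma symsumE a N : zpartial a N = symsum a N. Proof. by []. Qed.

Definition summable_seq a := exists B : R, forall N, symsum (normc \o a) N <= B.

Lemma symsum_bounded_cvg (u : int -> R) (B : R) :
  (forall k, 0 <= u k) -> (forall N, symsum u N <= B) ->
  cvgn (symsum u).
Proof.
move=> u0 uB; apply: nondecreasing_is_cvgn; first exact: nondecreasing_symsum.
by exists B => _ [N _ <-].
Qed.

(** Write [u] as [(|u| + u) - |u|], a difference of nonnegative sequences whose partial sums are
    bounded by [2 B] and [B]. *)
Lemma symsum_abs_cvg (u : int -> R) (B : R) :
  (forall N, symsum (fun k => `|u k|) N <= B) -> cvgn (symsum u).
Proof.
move=> uB.
have cv1 : cvgn (symsum (fun k => `|u k| + u k)).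
  apply: (@symsum_bounded_cvg _ (B *+ 2)) => [k|N].
    by rewrite -lerBlDl sub0r lerNl -normrN ler_norm.
  rewrite symsumD mulr2n lerD//; apply: le_trans (uB N).
  by apply: ler_symsum => k; rewrite ler_norm.
have cv2 : cvgn (symsum (fun k => `|u k|)) by exact: (@symsum_bounded_cvg _ B).
have -> : symsum u = symsum (fun k => `|u k| + u k) - symsum (fun k => `|u k|).
  by apply/funext => N; rewrite !fctE symsumD addrC addKr.
exact: is_cvgB.
Qed.

Lemma summable_cvg a : summable_seq a -> cvgn (zpartial a).
Proof.
move=> [B aB].
have [lr Hr] : exists l : R, (complex.Re (zpartial a N) : R) @[N --> \oo] --> l.
  apply/cvg_ex; rewrite (_ : (fun _ => _) = symsum (fun k => complex.Re (a k))).
    apply: (@symsum_abs_cvg _ B) => N; apply: le_trans (aB N).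
    by apply: ler_symsum => k /=; exact: ler_Re_normc.
  by apply/funext => N; rewrite symsumE (symsum_morph (f := @complex.Re R))//;
    exact: Re_add.
have [li Hi] : exists l : R, (complex.Im (zpartial a N) : R) @[N --> \oo] --> l.
  apply/cvg_ex; rewrite (_ : (fun _ => _) = symsum (fun k => complex.Im (a k))).
    apply: (@symsum_abs_cvg _ B) => N; apply: le_trans (aB N).
    by apply: ler_symsum => k /=; exact: ler_Im_normc.
  by apply/funext => N; rewrite symsumE (symsum_morph (f := @complex.Im R))//;
    exact: Im_add.
by apply/cvg_ex; exists (lr +i* li)%C; apply/cvgC_ReIm.
Qed.

Lemma zsum_cvg a (l : C) : zpartial a @ \oo --> (l : C^o) -> zsum a = l.
Proof. by move=> al; apply: (cvg_lim _ al); exact: norm_hausdorff. Qed.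

Lemma summable_zsum a : summable_seq a -> zpartial a @ \oo --> (zsum a : C^o).
Proof. exact: summable_cvg. Qed.

Lemma summable_le a b : (forall k, normc (a k) <= normc (b k)) ->
  summable_seq b -> summable_seq a.
Proof.
by move=> ab [B bB]; exists B => N; apply: le_trans (bB N); exact: ler_symsum.
Qed.

Lemma summableMl (x : C) a : summable_seq a -> summable_seq (fun k => x * a k).
Proof.
move=> [B aB]; exists (normc x * B) => N.
rewrite (@eq_symsum _ _ (fun k => normc x * normc (a k))); last first.
  by move=> k /=; rewrite normcM.
by rewrite symsumMl ler_wpM2l// normc_ge0.
Qed.

Lemma summable_bounded a b : dbounded a -> summable_seq b ->
  summable_seq (fun k => a k * b k).
Proof.
move=> [M aM] sb; apply: summable_le (summableMl (M%:C)%C sb) => k.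
rewrite !normcM ler_wpM2r ?normc_ge0// normc_real.
by rewrite (le_trans (aM k))// ler_norm.
Qed.

Lemma summable_oppr a : summable_seq a -> summable_seq (fun k => a (- k)).
Proof.
move=> [B aB]; exists B => N.
by rewrite (_ : _ \o _ = fun k => (normc \o a) (- k))// symsum_oppr.
Qed.

Lemma summable_cvg0 a : summable_seq a ->
  normc (a N%:Z) @[N --> \oo] --> (0 : R) /\
  normc (a (- N%:Z)) @[N --> \oo] --> (0 : R).
Proof.
move=> [B aB].
have cv : cvgn (symsum (normc \o a)).
  by apply: symsum_bounded_cvg aB => k; exact: normc_ge0.
have d0 : symsum (normc \o a) N.+1 - symsum (normc \o a) N @[N --> \oo] --> (0 : R).
  rewrite -(subrr (limn (symsum (normc \o a)))); apply: cvgB => //.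
  move/cvg_ex: cv => [l Hl]; rewrite (cvg_lim _ Hl)//.
  by rewrite (cvg_shiftS (symsum (normc \o a))).
split; rewrite -cvg_shiftS; apply: squeeze_cvgr (cvg_cst 0) d0;
  apply: nearW => N; rewrite normc_ge0/= symsumS addrC addKr/= ?lerDl ?lerDr;
  exact: normc_ge0.
Qed.

Lemma summable_succ a : summable_seq a -> summable_seq (fun k => a (k + 1)).
Proof.
move=> [B aB].
(* One [B] bounds the sum over the window [-N, N], the other the new end term at [N + 1], which
   belongs to the next window. *)
exists (B + B) => N.
rewrite (_ : _ \o _ = fun k => (normc \o a) (k + 1))// symsum_succ.
rewrite lerD ?aB// (le_trans _ (aB N.+1))// symsumS/=.
have := symsum_ge0 N (fun k => normc_ge0 (a k)) .
have := normc_ge0 (a (- N%:Z)); have := normc_ge0 (a (- N.+1%:Z)).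
rewrite -[symsum (normc \o a) N]/(symsum (fun k => normc (a k)) N).
lra.
Qed.

Lemma summable_shift a (q : int) : summable_seq a -> summable_seq (fun k => a (k + q)).
Proof.
have shiftn b (n : nat) : summable_seq b -> summable_seq (fun k => b (k + n%:Z)).
  elim: n => [|n IH] sb.
    by rewrite (_ : (fun _ => _) = b)//; apply/funext => k; rewrite addr0.
  have := summable_succ (IH sb); apply: summable_le => k.
  by rewrite -addrA -[1]/(1%:Z) -PoszD add1n.
case: q => n sa; first exact: shiftn.
have := summable_oppr (shiftn _ n.+1 (summable_oppr sa)).
by apply: summable_le => k; rewrite NegzE opprD opprK.
Qed.

Lemma zpartial_succ_cvg a (l : C^o) : summable_seq a ->
  zpartial a @ \oo --> l -> zpartial (fun k => a (k + 1)) @ \oo --> l.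
Proof.
move=> sa al; have [a1 a2] := summable_cvg0 sa.
apply: cvgC_perturb al _.
have a1' : normc (a N.+1%:Z) @[N --> \oo] --> (0 : R).
  by rewrite (cvg_shiftS (fun N : nat => normc (a N%:Z))).
have := cvgD a1' a2; rewrite addr0 => /(_ _) a12; apply: squeeze_cvgr (cvg_cst 0) a12.
apply: nearW => N; rewrite normc_ge0 /= !symsumE symsum_succ.
rewrite [X in normc X](_ : _ = a N.+1%:Z - a (- N%:Z)); last by rewrite addrC addKr.
by rewrite (le_trans (ler_normcD _ _))// normc_opp.
Qed.

Lemma zpartial_oppr a : zpartial (fun k => a (- k)) = zpartial a.
Proof. by apply/funext => N; rewrite !symsumE symsum_oppr. Qed.

(** Convergence of the symmetric sums alone would not do: those of the sign sequence all vanish, but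
    after a shift by one they tend to 2. Negative shifts reduce to positive ones by reflection,
    which leaves symmetric sums unchanged. *)
Lemma zpartial_shift_cvg a (q : int) (l : C^o) : summable_seq a ->
  zpartial a @ \oo --> l -> zpartial (fun k => a (k + q)) @ \oo --> l.
Proof.
have shiftn b (n : nat) : summable_seq b -> zpartial b @ \oo --> l ->
    zpartial (fun k => b (k + n%:Z)) @ \oo --> l.
  elim: n => [|n IH] sb bl.
    by rewrite (_ : (fun _ => _) = b)//; apply/funext => k; rewrite addr0.
  have := zpartial_succ_cvg (summable_shift n%:Z sb) (IH sb bl).
  by under eq_fun do rewrite -addrA -[1]/(1%:Z) -PoszD add1n.
case: q => n sa al; first exact: shiftn.
rewrite -zpartial_oppr.
have := @shiftn (fun k => a (- k)) n.+1 (summable_oppr sa).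
rewrite zpartial_oppr => /(_ al).
by under eq_fun do rewrite opprD -NegzE.
Qed.

Lemma summable_fin a (m : nat) :
  (forall k, ~~ (0 <= k <= m%:Z) -> a k = 0) -> summable_seq a.
Proof.
move=> a0; exists (\sum_(j < m.+1) normc (a j%:Z)) => N.
rewrite -(@symsum_fin _ (normc \o a) m (maxn m N)) ?leq_maxl//; last first.
  by move=> k /a0/= ->; rewrite normc0.
apply: nondecreasing_symsum; first by move=> k; exact: normc_ge0.
by rewrite leq_maxr.
Qed.

Lemma zpartial_fin a (q : int) (m : nat) :
  (forall k, ~~ (q <= k <= q + m%:Z) -> a k = 0) ->
  zpartial a @ \oo --> (\sum_(j < m.+1) a (q + j%:Z) : C^o).
Proof.
move=> a0; pose b k := a (k + q).
have b0 k : ~~ (0 <= k <= m%:Z) -> b k = 0 by move=> kb; apply: a0; lia.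
have := @zpartial_shift_cvg b (- q) (\sum_(j < m.+1) a (q + j%:Z)) (summable_fin b0).
have -> : (fun k => b (k - q)) = a by apply/funext => k; rewrite /b subrK.
apply; apply: cvg_near_cst; exists m => // N /= mN.
by rewrite symsumE (symsum_fin b0)//; apply: eq_bigr => j _; rewrite /b addrC.
Qed.

End Summable.

(** * Summability of the bounded inverse *)

Section Decay.
Variable R : realType.
Local Notation C := R[i].
Implicit Types (a b c d : int -> C) (p q : {poly C}).

(* Summing the triangle inequality for [c (k + 1) = z * c k + d k] over the window
   [-N, N] bounds [|1 - |z||] times the sum of the [|c k|] by [|d|_1 + |c|_oo],
   for [|z| < 1] and for [|z| > 1] alike. *)
Lemma summable_first_order (z : C) c : normc z != 1 -> dbounded c ->
  summable_seq (fun k => c (k + 1) - z * c k) -> summable_seq c.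
Proof.
move=> z1 [M cM] [D dD].
have M0 : 0 <= M by rewrite (le_trans (normc_ge0 (c 0))).
set P := symsum (normc \o c).
have sE N : symsum (fun k => normc (c (k + 1))) N =
    P N + (normc (c N.+1%:Z) - normc (c (- N%:Z))).
  by rewrite (@symsum_succ _ (normc \o c)).
have [zlt|zgt] : normc z < 1 \/ 1 < normc z.
  by apply/orP; rewrite -neq_lt.
- exists ((D + M) / (1 - normc z)) => N; rewrite ler_pdivlMr ?subr_gt0// -/P.
  have : symsum (fun k => normc (c (k + 1))) N <=
      symsum (fun k => normc z * normc (c k) + normc (c (k + 1) - z * c k)) N.
    apply: ler_symsum => k; rewrite -normcM.
    by rewrite -[X in normc X <= _](subrK (z * c k)) addrC ler_normcD.
  rewrite sE symsumD symsumMl -/P.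
  set x := (X in _ <= _ + X); have : x <= D by exact: dD.
  have := cM (- N%:Z); have := normc_ge0 (c N.+1%:Z); lra.
- exists ((D + M) / (normc z - 1)) => N; rewrite ler_pdivlMr ?subr_gt0// -/P.
  have : symsum (fun k => normc z * normc (c k)) N <=
      symsum (fun k => normc (c (k + 1)) + normc (c (k + 1) - z * c k)) N.
    apply: ler_symsum => k; rewrite -normcM.
    rewrite [X in _ <= _ + X]normc_dist.
    by rewrite -[X in normc X <= _](subrK (c (k + 1))) addrC ler_normcD.
  rewrite symsumD sE symsumMl -/P.
  set x := (X in _ <= _ + X); have : x <= D by exact: dD.
  have := cM N.+1%:Z; have := normc_ge0 (c (- N%:Z)); lra.
Qed.

(** The action of polynomials on sequences in which ['X] is the shift by one. Products of
    polynomials become compositions, so a factorisation of [p] can be undone factor by factor. *)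
Definition shift_poly p c (n : int) : C := \sum_(i < size p) p`_i * c (n + i%:Z).

Lemma shift_poly_widen p c (K : nat) n : (size p <= K)%N ->
  shift_poly p c n = \sum_(i < K) p`_i * c (n + i%:Z).
Proof.
move=> pK; rewrite /shift_poly (big_ord_widen K (fun i => p`_i * c (n + i%:Z)))//.
rewrite big_mkcond/=; apply: eq_bigr => i _; case: ltnP => // pi.
by rewrite nth_default// mul0r.
Qed.

Lemma shift_poly_XsubCM (z : C) q c n :
  shift_poly (('X - z%:P) * q) c n =
  shift_poly q c (n + 1) - z * shift_poly q c n.
Proof.
rewrite (@shift_poly_widen _ _ (size q).+1); last first.
  by rewrite (leq_trans (size_polyMleq _ _))// size_XsubC.
rewrite (@shift_poly_widen q c (size q).+1 n)// mulr_sumr.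
have -> : shift_poly q c (n + 1) =
    \sum_(i < (size q).+1) ('X * q)`_i * c (n + i%:Z).
  rewrite big_ord_recl/= coefXM mul0r add0r; apply: eq_bigr => i _.
  by rewrite coefXM/= /bump/= -addrA -PoszD.
rewrite -sumrB; apply: eq_bigr => i _.
by rewrite mulrBl coefB coefCM mulrBl mulrA.
Qed.

Lemma dbounded_shift_poly p c : dbounded c -> dbounded (shift_poly p c).
Proof.
move=> [M cM]; exists (\sum_(i < size p) normc p`_i * M) => n.
rewrite (le_trans (ler_normc_sum _ _ _))// ler_sum// => i _.
by rewrite normcM ler_wpM2l// normc_ge0.
Qed.

(** Over the complex numbers [p] splits into linear factors. Removing the factor ['X - z] is a
    first-order recurrence, settled by [summable_first_order]; the intermediate sequences stay
    bounded because they are images of [c] under polynomials. *)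
Lemma summable_shift_poly p c : p != 0 ->
  (forall z, root p z -> normc z != 1) -> dbounded c ->
  summable_seq (shift_poly p c) -> summable_seq c.
Proof.
move=> p0 pz cb.
have [rs prs] := closed_field_poly_normal p.
have rsz z : z \in rs -> normc z != 1.
  move=> zrs; apply: pz; rewrite prs rootZ ?lead_coef_eq0// root_prod_XsubC//.
have -> : shift_poly p c =
    (fun n => lead_coef p * shift_poly (\prod_(z <- rs) ('X - z%:P)) c n).
  apply/funext => n; rewrite [in LHS]prs (@shift_poly_widen _ _ _ _ (size_scale_leq _ _)).
  by rewrite mulr_sumr; apply: eq_bigr => i _; rewrite coefZ mulrA.
move=> /(summableMl (lead_coef p)^-1) sp.
have {sp} : summable_seq (shift_poly (\prod_(z <- rs) ('X - z%:P)) c).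
  by apply: summable_le sp => k; rewrite mulKf ?lead_coef_eq0.
move: rsz; elim: rs {prs} => [_|z rs IH rsz].
  rewrite big_nil; apply: summable_le => k.
  by rewrite /shift_poly size_poly1 big_ord_recl big_ord0 coef1 mul1r !addr0.
rewrite big_cons => sp; apply: IH.
  by move=> w wrs; apply: rsz; rewrite inE wrs orbT.
apply: (@summable_first_order z).
- by apply: rsz; rewrite inE eqxx.
- exact: dbounded_shift_poly.
- by apply: summable_le sp => k; rewrite shift_poly_XsubCM.
Qed.

End Decay.

Section Inverse.
Variable R : realType.
Local Notation C := R[i].
Implicit Types (a b c d : int -> C) (p q : {poly C}).

Lemma conv_invE a : proper_signal a ->
  dbounded (conv_inv a) /\ dinverse a (conv_inv a).
Proof.
move=> [_ [b [Hb _]]].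
have := @xgetPex _ (fun=> 0) [set b | dbounded b /\ dinverse a b].
by apply; exists b.
Qed.

Lemma conv_inv_unique a b : proper_signal a -> dbounded b -> dinverse a b ->
  conv_inv a = b.
Proof.
move=> ap bb ab; have [_ [c [_ uc]]] := ap.
by rewrite -(uc (conv_inv a) (conv_invE ap)) (uc b).
Qed.

Lemma dbounded_drev a : dbounded a -> dbounded (drev a).
Proof. by move=> [M aM]; exists M => n; rewrite normc_conj. Qed.

Lemma drevK a : drev (drev a) = a.
Proof. by apply/funext => n; rewrite /drev opprK conjcK. Qed.

Lemma zpartial_conj a (l : C^o) : zpartial a @ \oo --> l ->
  zpartial (fun k => (a k)^*%C) @ \oo --> (l^*%C : C^o).
Proof.
move=> /cvg_normcP al; apply/cvg_normcP.
rewrite (_ : (fun _ => _) = (fun N => normc (zpartial a N - l)))//.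
apply/funext => N; rewrite -[in RHS]normc_conj rmorphB/=; congr (normc (_ - _)).
by rewrite /zpartial rmorph_sum.
Qed.

Lemma dinverse_drev a b : dinverse a b -> dinverse (drev a) (drev b).
Proof.
move=> ab n; have := zpartial_conj (ab (- n)).
rewrite -zpartial_oppr.
have -> : (ddelta R (- n))^*%C = ddelta R n by rewrite /ddelta oppr_eq0 conjc_nat.
rewrite (_ : (fun k => _) = (fun k => drev a k * drev b (n - k)))//.
by apply/funext => k; rewrite rmorphM/= /drev; congr (_ * (b _)^*%C); lia.
Qed.

(** Conjugate reversal is an involution that preserves boundedness and sends inverses to inverses,
    so uniqueness is transported along with existence. *)
Lemma proper_drev a : proper_signal a -> proper_signal (drev a).
Proof.
move=> ap; have [ba [b [[bb ab] ub]]] := ap; split; first exact: dbounded_drev.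
exists (drev b); split.
  by split; [exact: dbounded_drev|exact: dinverse_drev].
move=> c [bc ac]; rewrite -[RHS]drevK (ub (drev c)) ?drevK//.
by split; [exact: dbounded_drev|rewrite -[a]drevK; exact: dinverse_drev].
Qed.

Lemma conv_inv_drev a : proper_signal a -> conv_inv (drev a) = drev (conv_inv a).
Proof.
move=> ap; have [ib ii] := conv_invE ap.
apply: conv_inv_unique; first exact: proper_drev.
  exact: dbounded_drev.
exact: dinverse_drev.
Qed.

(** With finite support the convergence demanded by [dinverse] is automatic, and being an inverse
    becomes a finite linear recurrence for [b]. *)
Lemma dinverse_fin a b (m : nat) : (forall k, ~~ (0 <= k <= m%:Z) -> a k = 0) ->
  dinverse a b <-> forall n, \sum_(j < m.+1) a j%:Z * b (n - j%:Z) = ddelta R n.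
Proof.
move=> a0.
have cv n : zpartial (fun k => a k * b (n - k)) @ \oo -->
    (\sum_(j < m.+1) a j%:Z * b (n - j%:Z) : C^o).
  have := @zpartial_fin _ (fun k => a k * b (n - k)) 0 m.
  under eq_bigr do rewrite add0r.
  by apply=> k km; rewrite a0 ?mul0r// -[m%:Z]add0r.
split=> [ab n|ab n]; last by rewrite -ab.
have ab' := ab n.
by rewrite -(zsum_cvg ab') (zsum_cvg (cv n)).
Qed.

(** The polynomial [p] with the coefficients of [a] sends the reflected inverse [n |-> b (- n)] to
    the unit impulse. A bounded sequence with a summable image is summable once [p] has no root of
    modulus 1. *)
Theorem conv_inv_summable a (m : nat) :
  (forall k, ~~ (0 <= k <= m%:Z) -> a k = 0) -> proper_signal a ->
  summable_seq (conv_inv a).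
Proof.
move=> a0 ap; have [bb ab] := conv_invE ap; set b := conv_inv a in bb ab *.
have /dinverse_fin -/(_ _ a0) abE := ab.
pose p : {poly C} := \poly_(j < m.+1) a j%:Z.
have act c n : shift_poly p c n = \sum_(j < m.+1) a j%:Z * c (n + j%:Z).
  rewrite (@shift_poly_widen _ _ _ m.+1 _ (size_poly _ _)).
  by apply: eq_bigr => j _; rewrite coef_poly ltn_ord.
have p0 : p != 0.
  apply/eqP => p0; have := act (fun n => b (- n)) 0.
  rewrite p0 /shift_poly size_poly0 big_ord0.
  have := abE 0; under eq_bigr do rewrite sub0r.
  under [in X in _ -> X -> _]eq_bigr do rewrite add0r.
  by move=> -> /esym/eqP; rewrite oner_eq0.
(* A root on the unit circle would give a bounded [e] with [a * e = 0], and
   [b + e] would be a second bounded inverse. *)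
have pz z : root p z -> normc z != 1.
  move=> /eqP pz; apply/eqP => z1.
  have z0 : z != 0 by apply: contra_eq_neq z1 => ->; rewrite normc0 eq_sym oner_eq0.
  have ez (n : int) : normc (z ^ n) = 1.
    have nat1 (k : nat) : normc (z ^+ k) = 1.
      elim: k => [|k IH]; first by rewrite expr0 normc1.
      by rewrite exprS normcM z1 IH mulr1.
    case: n => k; rewrite ?NegzE -?exprnP ?nat1//.
    by rewrite -exprnN normcV nat1 invr1.
  have [M bM] := bb.
  have eb : conv_inv a = (fun n => b n + z ^ (- n)).
    apply: conv_inv_unique => //.
      exists (M + 1) => n; rewrite (le_trans (ler_normcD _ _))//.
      by rewrite lerD// ez.
    apply/(dinverse_fin _ a0) => n.
    under eq_bigr do rewrite mulrDr.
    rewrite big_split/= abE.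
    rewrite (_ : \sum_(j < _) _ = z ^ (- n) * p.[z]).
      by rewrite pz mulr0 addr0.
    rewrite horner_poly mulr_sumr; apply: eq_bigr => j _.
    by rewrite opprB addrC exprzDr ?unitfE// mulrCA.
  have := congr1 (@^~ 0) eb; rewrite /= -/b oppr0 expr0z => /eqP.
  by rewrite -[X in X == _]addr0 eq_sym (inj_eq (addrI _)) oner_eq0.
have : summable_seq (fun n => b (- n)).
  apply: summable_shift_poly p0 pz _ _.
    by have [M bM] := bb; exists M => n.
  apply: (@summable_fin _ _ 0) => k k0; rewrite act.
  have := abE (- k); rewrite /ddelta.
  have -> : (- k == 0) = false by apply/eqP; lia.
  rewrite mulr0n => abk; rewrite -[RHS]abk; apply: eq_bigr => j _.
  by rewrite opprD.
by move=> /summable_oppr; apply: summable_le => k; rewrite opprK.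
Qed.

End Inverse.

(** * Convolution with impulse trains *)

Section ImpulseTrains.
Variable R : realType.
Local Notation C := R[i].
Implicit Types (a b c d : int -> C) (g h : R -> C) (t : R).

(** The substitution [k |-> q - k] moves the centre of the summation window by [q], hence the
    summability assumption. *)
Lemma zpartial_conv_comm a b (q : int) (l : C^o) :
  summable_seq (fun k => a k * b (q - k)) ->
  zpartial (fun k => a k * b (q - k)) @ \oo --> l ->
  zpartial (fun k => b k * a (q - k)) @ \oo --> l.
Proof.
move=> sab abl; have := zpartial_shift_cvg q sab abl.
rewrite -zpartial_oppr (_ : (fun k => _) = (fun k => b k * a (q - k)))//.
by apply/funext => k; rewrite mulrC; congr (b _ * a _); lia.
Qed.

Lemma cvgC_sum (K : nat) (f : 'I_K -> nat -> C^o) (l w : 'I_K -> C) :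
  (forall j, f j @ \oo --> (l j : C^o)) ->
  (fun N => (\sum_(j < K) (f j N : C) * w j : C^o)) @ \oo -->
  (\sum_(j < K) l j * w j : C^o).
Proof.
move=> fl; apply/cvg_normcP.
have cv0 : \sum_(j < K) normc ((f j N : C) - l j) * normc (w j) @[N --> \oo] --> (0 : R).
  rewrite [X in _ --> X](_ : 0 = \sum_(j < K) 0 * normc (w j)).
    by apply: cvg_big => [|j _]; [exact: add_continuous|apply: cvgMr_tmp; exact/cvg_normcP].
  by rewrite big1// => j _; rewrite mul0r.
apply: squeeze_cvgr (cvg_cst 0) cv0; apply: nearW => N; rewrite normc_ge0/=.
rewrite [X in normc X](_ : _ = \sum_(j < K) ((f j N : C) - l j) * w j).
  rewrite (le_trans (ler_normc_sum _ _ _))// ler_sum// => j _.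
  by rewrite normcM.
rewrite -[LHS]/((\sum_(j < K) _ : C) - (\sum_(j < K) _ : C)) -sumrB.
by apply: eq_bigr => j _; rewrite mulrBl.
Qed.

Section CompactSupport.
Variables (m : nat) (g : R -> C).
Hypothesis g0 : forall t, ~ (0 < t < m.+1%:R) -> g t = 0.

Lemma pconv_cvg_fin b t :
  zpartial (fun n => b n * g (t - n%:~R)) @ \oo -->
  (\sum_(j < m.+1) b (Num.floor t - m%:Z + j%:Z) *
     g (t - (Num.floor t - m%:Z + j%:Z)%:~R) : C^o).
Proof.
(* A nonzero term needs [t - (m + 1) < k < t], so [k] is among the [m + 1] integers ending at
   [floor t]. *)
apply: (@zpartial_fin _ _ (Num.floor t - m%:Z) m) => k kb.
rewrite g0 ?mulr0// => /andP[]; rewrite subr_gt0 ltrBlDr => kt tm.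
have k1 : (k <= Num.floor t)%R by rewrite floor_ge_int ltW.
have : Num.floor t < m.+1%:Z + k.
  by rewrite -(ltr_int R) (le_lt_trans (Num.Theory.floor_le_tmp t))// rmorphD.
by move: kb k1; set f := Num.floor t; lia.
Qed.

Lemma pconv_fin b t : pconv b g t =
  \sum_(j < m.+1) b (Num.floor t - m%:Z + j%:Z) *
     g (t - (Num.floor t - m%:Z + j%:Z)%:~R).
Proof. by rewrite /pconv; apply: zsum_cvg; exact: pconv_cvg_fin. Qed.

Lemma pconv_cvg b t :
  zpartial (fun n => b n * g (t - n%:~R)) @ \oo --> (pconv b g t : C^o).
Proof. by rewrite pconv_fin; exact: pconv_cvg_fin. Qed.

(** Associativity. Because [floor (t - n) = floor t - n], the inner finite sum evaluates [g] at the
    same points [t - q j] whatever [n] is. The outer series is thus a finite combination, with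
    weights [g (t - q j)], of the series defining the convolution of [drev b] and [b] at [q j]. *)
Lemma pconv_drev_cvg b t : dbounded b -> summable_seq b ->
  zpartial (fun n => drev b n * pconv b g (t - n%:~R)) @ \oo -->
  (pconv (dconv b (drev b)) g t : C^o).
Proof.
move=> bb sb; pose q (j : nat) : int := Num.floor t - m%:Z + j%:Z.
have -> : zpartial (fun n => drev b n * pconv b g (t - n%:~R)) =
    fun N => \sum_(j < m.+1)
      (zpartial (fun n => drev b n * b (q j - n)) N : C) * g (t - (q j)%:~R).
  apply/funext => N; rewrite /zpartial; under [RHS]eq_bigr do rewrite mulr_suml.
  rewrite exchange_big/=; apply: eq_bigr => k _; set n := (_ - _ in LHS).
  rewrite pconv_fin mulr_sumr; apply: eq_bigr => j _.
  have -> : Num.floor (t - n%:~R) = Num.floor t - n.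
    by rewrite -mulrNz floorDrz ?intr_int// intrKfloor.
  rewrite mulrA; congr (_ * b _ * g _); first by rewrite /q; lia.
  by rewrite /q !(rmorphD, rmorphN, rmorphB)/=; lra.
rewrite pconv_fin; apply: cvgC_sum => j; rewrite -/(q j).
have sq : summable_seq (fun k => b k * drev b (q j - k)).
  have [B bB] := bb; under eq_fun do rewrite mulrC.
  apply: summable_bounded => //; exists B => k.
  by rewrite normc_conj.
by apply: zpartial_conv_comm => //; exact: summable_zsum.
Qed.

(** Convergence of the series for [h] is a result here: its partial sums differ from those of
    [pconv_drev_cvg] by a sequence tending to 0. *)
Lemma pconv_drev_eq b h t : dbounded b -> summable_seq b ->
  zpartial (fun n => drev b n * (h (t - n%:~R) - pconv b g (t - n%:~R)))
    @ \oo --> (0 : C^o) ->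
  pconv (drev b) h t = pconv (dconv b (drev b)) g t.
Proof.
move=> bb sb /cvg_normcP d0; rewrite [LHS]/pconv; apply: zsum_cvg.
apply: (cvgC_perturb (pconv_drev_cvg bb sb)).
rewrite [X in X @ _ --> _](_ : _ = (fun N => normc ((zpartial (fun n =>
  drev b n * (h (t - n%:~R) - pconv b g (t - n%:~R))) N : C) - 0)))//.
apply/funext => N; rewrite subr0 /zpartial -sumrB; congr normc.
by apply: eq_bigr => k _; rewrite mulrBr.
Qed.

Lemma pconv_conv_inv_int a (k : int) :
  (forall n, ~~ (0 <= n <= m%:Z) -> a n = 0) -> proper_signal a ->
  samples g = a -> pconv (conv_inv a) g k%:~R = ddelta R k.
Proof.
move=> a0 ap ga; rewrite /pconv; apply: zsum_cvg; have [bb ab] := conv_invE ap.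
rewrite (_ : (fun n => _) = (fun n => conv_inv a n * a (k - n))); last first.
  by apply/funext => n; rewrite -ga /samples rmorphB.
apply: zpartial_conv_comm => //.
apply: (@summable_fin _ _ m) => n /a0 ->; exact: mul0r.
Qed.

End CompactSupport.
End ImpulseTrains.

(** * Admissible perturbations *)

Section Perturbation.
Variable R : realType.
Local Notation C := R[i].
Local Notation mu := (@lebesgue_measure R).
Implicit Types (y : R -> C) (A B : set R) (c : C).

Definition step c A (t : R) : C := c * ((\1_A t : R)%:C)%C.

Lemma Re_step c A t : complex.Re (step c A t) = complex.Re c * \1_A t.
Proof. by rewrite /step Re_mul/= mulr0 subr0. Qed.

Lemma Im_step c A t : complex.Im (step c A t) = complex.Im c * \1_A t.
Proof. by rewrite /step Im_mul/= mulr0 add0r. Qed.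

Lemma step_notin c A t : ~ A t -> step c A t = 0.
Proof. by move=> At; rewrite /step indicE memNset//= mulr0. Qed.

Lemma normc_step_le c A t : normc (step c A t) <= normc c.
Proof.
rewrite normcM normc_real ler_piMr ?normc_ge0//.
by rewrite indicE ger0_norm ?ler0n//; case: (_ \in _); rewrite ?lexx ?ler01.
Qed.

Lemma integrable_indic_lty A : measurable A -> (mu A < +oo)%E ->
  mu.-integrable setT (fun t => (\1_A t)%:E).
Proof.
move=> mA Aoo; apply/integrableP; split; first exact/measurable_EFinP.
under eq_integral do rewrite gee0_abs ?lee_fin//.
by rewrite integral_indic// setIT.
Qed.

Lemma integrable_indicZ (k : R) A : measurable A -> (mu A < +oo)%E ->
  mu.-integrable setT (fun t => (k * \1_A t)%:E).
Proof.
move=> mA Aoo; rewrite (_ : (fun _ => _) = (fun t => (k%:E * (\1_A t)%:E)%E)).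
  by apply: integrableZl => //; exact: integrable_indic_lty.
by apply/funext => t; rewrite EFinM.
Qed.

(* [class_D] is not closed under addition (a sum can acquire infinitely many
   extrema), so only locally constant perturbations are used. *)
Lemma class_D_step y c A B : class_D y -> measurable A -> (mu A < +oo)%E ->
  finite_set B ->
  (forall t, ~ B t -> \forall z \near t, (\1_A z : R) = \1_A t) ->
  class_D (fun t => y t + step c A t).
Proof.
move=> [fe fd [iR iI] [M yM]] mA Aoo finB Aloc.
(* Where the indicator is locally constant, both sides of the comparison defining an extremum move
   by the same amount; [p] stands for the real or the imaginary part. *)
have ext (p : C -> R) x : {morph p : u v / u + v} ->
    ~ B x -> strict_extremum (fun t => p (y t + step c A t)) x ->
    strict_extremum (fun t => p (y t)) x.
  move=> pD nBx; have nA : \forall z \near x^', \1_A z = \1_A x :> R.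
    by apply: cvg_within; exact: Aloc.
  have stepE z : \1_A z = \1_A x :> R -> step c A z = step c A x.
    by rewrite /step => ->.
  by case=> H; [left|right]; move: H; apply: filterS2 nA => z /stepE ->;
    rewrite !pD ltrD2r.
split.
- move=> u v; apply: (@sub_finite_set _ _ ([set x | u <= x <= v /\
    (strict_extremum (fun t => complex.Re (y t)) x \/
     strict_extremum (fun t => complex.Im (y t)) x)] `|` B)); last first.
    by rewrite finite_setU; split => //; exact: fe.
  move=> x [xuv ex]; have [Bx|nBx] := pselect (B x); [by right|left].
  split=> //; case: ex => [/(ext _ _ (@Re_add R) nBx)|/(ext _ _ (@Im_add R) nBx)] ?.
    by left.
  by right.
- move=> u v; apply: (@sub_finite_set _ _ ([set x | u <= x <= v /\
      ~ {for x, continuous (y : R -> C^o)}] `|` B)); last first.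
    by rewrite finite_setU; split => //; exact: fd.
  move=> x [xuv nc]; have [Bx|nBx] := pselect (B x); [by right|left].
  split; first exact: xuv.
  move=> cy; apply: nc; apply/cvg_normcP.
  move/cvg_normcP : cy; apply: cvg_trans; apply: near_eq_cvg.
  apply: filterS (Aloc _ nBx) => z Az /=; rewrite /step Az.
  by rewrite opprD addrACA subrr addr0.
- split.
  + rewrite (_ : (fun _ => _) =
      (fun t => (complex.Re (y t))%:E + (complex.Re c * \1_A t)%:E)%E).
      by apply: integrableD => //; exact: integrable_indicZ.
    by apply/funext => t; rewrite Re_add Re_step.
  + rewrite (_ : (fun _ => _) =
      (fun t => (complex.Im (y t))%:E + (complex.Im c * \1_A t)%:E)%E).
      by apply: integrableD => //; exact: integrable_indicZ.
    by apply/funext => t; rewrite Im_add Im_step.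
- exists (M + normc c) => t.
  by rewrite (le_trans (ler_normcD _ _))// lerD// normc_step_le.
Qed.

Definition nat_upto (m : nat) : set R := [set k%:R | k in `I_m.+2].

(* The integers are removed so that adding a step does not change the samples. *)
Definition punctured_itv (m : nat) (x : R) : set R := `]0, x[ `\` nat_upto m.

Lemma finite_nat_upto m : finite_set (nat_upto m).
Proof. exact/finite_image/finite_II. Qed.

Lemma closed_nat_upto m : closed (nat_upto m).
Proof.
apply: compact_closed; first exact: Rhausdorff.
exact: finite_compact (finite_nat_upto m).
Qed.

Lemma measurable_punctured_itv m x : measurable (punctured_itv m x).
Proof.
by apply: measurableD => //; apply: closed_measurable; exact: closed_nat_upto.
Qed.

Lemma punctured_itv_lty m x : (mu (punctured_itv m x) < +oo)%E.
Proof.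
apply: (@le_lt_trans _ _ (mu `]0, x[)).
  apply: le_measure; rewrite ?inE//; first exact: measurable_punctured_itv.
  by move=> t [].
by rewrite lebesgue_measure_itv/=; case: ifPn => // _; rewrite -EFinB ltry.
Qed.

Lemma punctured_itv_natN m x (n : nat) : x <= m.+1%:R -> ~ punctured_itv m x n%:R.
Proof.
move=> xm [/=]; rewrite in_itv/= => /andP[_ nx]; apply.
by exists n => //=; rewrite -(ltr_nat R) (lt_le_trans nx)// (le_trans xm)// ler_nat.
Qed.

(** A remaining point lies in one of three open sets: the negative half-line, the half-line beyond
    [x], or the punctured interval itself, open because [nat_upto m] is closed. The jump at the left
    end is excluded since 0 belongs to [nat_upto m]. *)
Lemma punctured_itv_loc m x t : ~ (nat_upto m `|` [set x]) t ->
  \forall z \near t, (\1_(punctured_itv m x) z : R) = \1_(punctured_itv m x) t.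
Proof.
move=> /not_orP[nt /eqP tx].
have outside u : ~ 0 < u < x -> ~ punctured_itv m x u.
  by move=> ux -[/=]; rewrite in_itv.
have [t0|t0] := ltP t 0.
  near=> z; rewrite !indicE !memNset//; apply: outside.
    by rewrite ltNge (ltW t0).
  have z0 : z < 0 by near: z; exact: lt_nbhsl.
  by rewrite ltNge (ltW z0).
have {}t0 : 0 < t.
  rewrite lt_neqAle t0 andbT; apply/eqP => t0E; apply: nt.
  by exists 0%N.
have [xt|tx'] := ltP x t.
  near=> z; rewrite !indicE !memNset//; apply: outside.
    by rewrite andbC ltNge (ltW xt).
  have xz : x < z by near: z; exact: lt_nbhsr.
  by rewrite andbC ltNge (ltW xz).
have {}tx : t < x by rewrite lt_neqAle tx.
have tU : (`]0, x[ `\` nat_upto m) t by split=> //=; rewrite in_itv/= t0.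
have oU : open (`]0, x[ `\` nat_upto m : set R).
  rewrite setDE; apply: openI; first exact: interval_open.
  by rewrite openC; exact: closed_nat_upto.
near=> z; rewrite !indicE !mem_set//.
by near: z; exact: open_nbhs_nbhs.
Unshelve. all: by end_near. Qed.

Lemma chi_step (m : nat) (rho_d : int -> C) y c x : x <= m.+1%:R ->
  chi m rho_d y -> chi m rho_d (fun t => y t + step c (punctured_itv m x) t).
Proof.
move=> xm [yD yn y0]; split.
- apply: (@class_D_step _ _ _ (nat_upto m `|` [set x])) => //.
  + exact: measurable_punctured_itv.
  + exact: punctured_itv_lty.
  + by rewrite finite_setU; split; [exact: finite_nat_upto|exact: finite_set1].
  + exact: punctured_itv_loc.
- by move=> n; rewrite step_notin ?addr0//; exact: punctured_itv_natN.
- move=> t t0; rewrite y0// add0r step_notin// => -[/=]; rewrite in_itv/=.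
  by move=> /andP[t0' tx] _; apply: t0; rewrite t0'/= (lt_le_trans tx).
Qed.

End Perturbation.

(** * Square integrable signals *)

Section ShiftInvariance.
Variable R : realType.
Local Notation mu := (@lebesgue_measure R).
Local Notation mR := (measurableTypeR R).

Lemma measurable_shift (a : R) : measurable_fun setT (fun t : mR => t + a : mR).
Proof. exact: measurable_funD. Qed.

(** Lebesgue measure is determined by its values on half-open intervals, whose lengths are unchanged
    by translation. *)
Lemma lebesgue_measure_shift (a : R) (A : set mR) : measurable A ->
  pushforward mu (fun t : mR => t + a : mR) A = mu A.
Proof.
pose s := fun t : mR => t + a : mR.
have ms : measurable_fun setT s := measurable_shift a.
pose ms' := isMeasurableFun.Build _ _ _ _ _ ms.
pose s' : {mfun mR >-> mR} := HB.pack s ms'.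
move=> mA; apply/esym.
apply: (@lebesgue_measure_unique R (pushforward mu s' : {measure set mR -> \bar R})) => //.
move=> _ [[u v] _ <-]; rewrite /pushforward /=.
rewrite [X in _ = mu X](_ : _ = `]u - a, v - a]%classic); last first.
  by apply/seteqP; split => t /=; rewrite !in_itv/= ltrBlDr lerBrDr.
rewrite !lebesgue_measure_itv/= !lte_fin ltrD2r.
by case: ifP => // _; congr (_%:E); ring.
Qed.

Lemma ge0_integral_shift (a : R) (f : R -> \bar R) :
  measurable_fun (setT : set mR) f -> (forall t, 0 <= f t)%E ->
  (\int[mu]_t f ((t : R) + a)%R = \int[mu]_t f t)%E.
Proof.
move=> mf f0.
have := @ge0_integral_pushforward _ _ _ _ R _ (measurable_shift a) mu setT f
  measurableT mf (fun t _ => f0 t).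
rewrite preimage_setT => <-.
apply: eq_measure_integral => [|? A mA _]; first exact: (measurable_shift a).
exact: lebesgue_measure_shift.
Qed.

Lemma integrable_shift (a : R) (f : R -> \bar R) :
  mu.-integrable setT f -> mu.-integrable setT (fun t : R => f (t + a)).
Proof.
move=> /integrableP[mf foo]; apply/integrableP; split.
  exact: (measurableT_comp mf (measurable_shift a)).
by rewrite (ge0_integral_shift a (f := fun t : R => `|f t|%E))//; exact: measurableT_comp.
Qed.

Lemma integral_shift (a : R) (f : R -> \bar R) :
  mu.-integrable setT f -> (\int[mu]_t f ((t : R) + a)%R = \int[mu]_t f t)%E.
Proof.
move=> fi; have [mf _] := integrableP _ _ _ fi.
have fi' : mu.-integrable ((fun t : mR => t + a : mR) @^-1` setT)
    (f \o (fun t : mR => t + a : mR)).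
  by rewrite preimage_setT; exact: integrable_shift.
have := @integral_pushforward _ _ _ _ R _ (measurable_shift a) mu setT f
  mf fi' measurableT.
rewrite preimage_setT => <-.
apply: eq_measure_integral => [|? A mA _]; first exact: (measurable_shift a).
exact: lebesgue_measure_shift.
Qed.

Lemma integral_symsum_shift (u : int -> R) (f : R -> R) (N : nat) :
  (forall n, 0 <= u n) -> (forall t, 0 <= f t) ->
  measurable_fun (setT : set mR) f ->
  (\int[mu]_t (symsum (fun n => u n * f ((t : R) - n%:~R)) N)%:E =
   (symsum u N)%:E * \int[mu]_t (f t)%:E)%E.
Proof.
move=> u0 f0 mf.
have mfs (a : R) : measurable_fun (setT : set mR) (fun t : R => f (t + a)).
  exact: (measurableT_comp mf (measurable_shift a)).
under eq_integral do rewrite /symsum -sumEFin.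
rewrite ge0_integral_sum//; first last.
- by move=> k t _; rewrite lee_fin mulr_ge0.
- by move=> k; apply/measurable_EFinP; apply: measurable_funM => //; exact: mfs.
rewrite /symsum -sumEFin ge0_sume_distrl; last by move=> k _; rewrite lee_fin.
apply: eq_bigr => k _; under eq_integral do rewrite EFinM.
rewrite ge0_integralZl_EFin//; first last.
- by apply/measurable_EFinP; exact: mfs.
- by move=> t _; rewrite lee_fin.
congr (_ * _)%E; apply: (@ge0_integral_shift _ (fun t : R => (f t)%:E)).
- exact/measurable_EFinP.
- by move=> t; rewrite lee_fin.
Qed.

End ShiftInvariance.

(** * Square integrable signals and their convolutions with summable trains *)

Section SquareIntegrable.
Variable R : realType.
Local Notation C := R[i].
Local Notation mu := (@lebesgue_measure R).
Local Notation mR := (measurableTypeR R).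
Implicit Types (y g r : R -> C) (b : int -> C).

Definition measurable_cfun y :=
  measurable_fun (setT : set mR) (fun t => complex.Re (y t)) /\
  measurable_fun (setT : set mR) (fun t => complex.Im (y t)).

Definition sq_integrable y := measurable_cfun y /\
  mu.-integrable setT (fun t => (normc (y t) ^+ 2)%:E).

Lemma measurable_normc y : measurable_cfun y ->
  measurable_fun (setT : set mR) (fun t => normc (y t)).
Proof.
move=> [mr mi].
rewrite (_ : (fun _ => _) =
  (fun t => Num.sqrt (complex.Re (y t) ^+ 2 + complex.Im (y t) ^+ 2))).
  apply: measurableT_comp.
    apply: continuous_measurable_fun; exact: sqrt_continuous.
  by apply: measurable_funD; exact: measurable_funX.
by apply/funext => t; case: (y t).
Qed.

Lemma measurable_cfunD y g : measurable_cfun y -> measurable_cfun g ->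
  measurable_cfun (fun t => y t + g t).
Proof.
move=> [y1 y2] [g1 g2]; split.
  by under eq_fun do rewrite Re_add; exact: measurable_funD.
by under eq_fun do rewrite Im_add; exact: measurable_funD.
Qed.

Lemma measurable_cfunM y g : measurable_cfun y -> measurable_cfun g ->
  measurable_cfun (fun t => y t * g t).
Proof.
move=> [y1 y2] [g1 g2]; split.
  by under eq_fun do rewrite Re_mul; apply: measurable_funB; exact: measurable_funM.
by under eq_fun do rewrite Im_mul; apply: measurable_funD; exact: measurable_funM.
Qed.

Lemma measurable_cfun_cst (c : C) : measurable_cfun (fun=> c).
Proof. by split; exact: measurable_cst. Qed.

Lemma measurable_cfun_conj y : measurable_cfun y -> measurable_cfun (fun t => (y t)^*%C).
Proof.
move=> [y1 y2]; split; first by under eq_fun do rewrite Re_conjc.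
by under eq_fun do rewrite Im_conjc; exact: measurable_funN.
Qed.

Lemma measurable_cfun_shift (a : R) y : measurable_cfun y ->
  measurable_cfun (fun t => y (t + a)).
Proof.
move=> [y1 y2]; split; first exact: (measurableT_comp y1 (measurable_shift a)).
exact: (measurableT_comp y2 (measurable_shift a)).
Qed.

Lemma measurable_cfun_symsum (f : int -> R -> C) N :
  (forall n, measurable_cfun (f n)) -> measurable_cfun (fun t => symsum (f^~ t) N).
Proof.
move=> mf; split.
  rewrite (_ : (fun _ => _) = (fun t => symsum (fun n => complex.Re (f n t)) N)).
    by apply: measurable_sum => k; exact: (mf _).1.
  by apply/funext => t; rewrite (symsum_morph (f := @complex.Re R))//; exact: Re_add.
rewrite (_ : (fun _ => _) = (fun t => symsum (fun n => complex.Im (f n t)) N)).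
  by apply: measurable_sum => k; exact: (mf _).2.
by apply/funext => t; rewrite (symsum_morph (f := @complex.Im R))//; exact: Im_add.
Qed.

Lemma measurable_cfun_cvg (z : nat -> R -> C) y :
  (forall N, measurable_cfun (z N)) ->
  (forall t, (fun N => z N t : C^o) @ \oo --> (y t : C^o)) -> measurable_cfun y.
Proof.
move=> mz zy; split.
  apply: (@measurable_fun_cvg _ _ _ _ (fun N t => complex.Re (z N t))) => [N|t _].
    exact: (mz N).1.
  by have /cvgC_ReIm[] := zy t.
apply: (@measurable_fun_cvg _ _ _ _ (fun N t => complex.Im (z N t))) => [N|t _].
  exact: (mz N).2.
by have /cvgC_ReIm[] := zy t.
Qed.

Lemma measurable_normc_sqr y : measurable_cfun y ->
  measurable_fun (setT : set mR) (fun t => normc (y t) ^+ 2).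
Proof. by move=> my; apply: measurable_funX; exact: measurable_normc. Qed.

Lemma L2norm_poweR y :
  (L2norm y `^ 2 = \int[mu]_t (normc (y t) ^+ 2)%:E)%E.
Proof.
rewrite /L2norm poweR_Lnorm//; apply: eq_integral => t _.
by rewrite gee0_abs ?lee_fin ?normc_ge0// poweR_EFin -powR_mulrn ?normc_ge0.
Qed.

Lemma L2norm_le_int y g : (L2norm y <= L2norm g)%E ->
  (\int[mu]_t (normc (y t) ^+ 2)%:E <= \int[mu]_t (normc (g t) ^+ 2)%:E)%E.
Proof.
rewrite -!L2norm_poweR => yg; apply: gt0_ler_poweR => //.
- by rewrite in_itv/= leey Lnorm_ge0.
- by rewrite in_itv/= leey Lnorm_ge0.
Qed.

Lemma in_L2_sq_integrable y : in_L2 y -> sq_integrable y.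
Proof.
move=> [mr mi yoo]; split; first by split.
apply/integrableP; split.
  by apply/measurable_EFinP; exact: (@measurable_normc_sqr y).
under eq_integral do rewrite gee0_abs ?lee_fin ?sqr_ge0//.
by rewrite -L2norm_poweR poweR_lty.
Qed.

Lemma sq_integrableB y g : sq_integrable y -> sq_integrable g ->
  sq_integrable (fun t => y t - g t).
Proof.
move=> [my iy] [mg ig].
have m : measurable_cfun (fun t => y t - g t).
  rewrite (_ : (fun _ => _) = (fun t => y t + (-1) * g t)).
    by apply: measurable_cfunD => //; apply: measurable_cfunM => //;
      exact: measurable_cfun_cst.
  by apply/funext => t; rewrite mulN1r.
split=> //.
have i2 : mu.-integrable setT (fun t => (2 * normc (y t) ^+ 2 + 2 * normc (g t) ^+ 2)%:E).
  rewrite (_ : (fun _ => _) =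
    (fun t => (2%:E * (normc (y t) ^+ 2)%:E) + (2%:E * (normc (g t) ^+ 2)%:E))%E).
    by apply: integrableD => //; exact: integrableZl.
  by apply/funext => t; rewrite EFinD !EFinM.
apply: le_integrable i2 => //.
  by apply/measurable_EFinP; exact: measurable_normc_sqr.
move=> t _; rewrite lee_fin !ger0_norm ?addr_ge0 ?mulr_ge0 ?sqr_ge0 ?normc_ge0//.
have := ler_normcD (y t) (- g t); rewrite normc_opp.
have := normc_ge0 (y t - g t); have := normc_ge0 (y t); have := normc_ge0 (g t).
move: (normc _) (normc _) (normc _) => d c a a0 c0 d0 dac.
have : d ^+ 2 <= (c + a) ^+ 2 by rewrite ler_pXn2r// ?nnegrE ?addr_ge0.
have := sqr_ge0 (c - a); rewrite !expr2; lra.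
Qed.

(** A uniform bound times an L^1 bound: the partial sums are at most [v N <= B * M] in modulus, and
    the integral of [v N] is at most [B] times that of [|g|]. Their squares thus have integrals
    bounded independently of [N], and Fatou's lemma passes to the limit. *)
Lemma pconv_sq_integrable b g (m : nat) (M : R) : summable_seq b ->
  (forall t, ~ (0 < t < m.+1%:R) -> g t = 0) ->
  measurable_cfun g -> (forall t, normc (g t) <= M) ->
  mu.-integrable setT (fun t => (normc (g t))%:E) ->
  sq_integrable (pconv b g).
Proof.
move=> [B bB] g0 mg gM ig.
have M0 : 0 <= M by rewrite (le_trans (normc_ge0 (g 0))).
have B0 : 0 <= B by rewrite (le_trans _ (bB 0%N))// symsum0 normc_ge0.
pose z (N : nat) t : C := zpartial (fun n => b n * g (t - n%:~R)) N.
have zc t : (fun N => z N t : C^o) @ \oo --> (pconv b g t : C^o).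
  exact: (pconv_cvg g0).
have mz N : measurable_cfun (z N).
  apply: (@measurable_cfun_symsum (fun n t => b n * g (t - n%:~R)) N) => n.
  apply: measurable_cfunM.
    exact: measurable_cfun_cst.
  exact: measurable_cfun_shift.
have mp : measurable_cfun (pconv b g) := measurable_cfun_cvg mz zc.
pose v N t := symsum (fun n => normc (b n) * normc (g (t - n%:~R))) N.
have zv N t : normc (z N t) <= v N t.
  rewrite (le_trans (ler_normc_sum _ _ _))//; apply: ler_sum => k _.
  by rewrite normcM.
have vB N t : v N t <= B * M.
  rewrite (@le_trans _ _ (symsum (fun n => normc (b n) * M) N))//.
    by apply: ler_symsum => n; rewrite ler_wpM2l// normc_ge0.
  by rewrite symsumMr ler_wpM2r//; exact: bB.
have v0 N t : 0 <= v N t.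
  by apply: symsum_ge0 => n; rewrite mulr_ge0 ?normc_ge0.
split=> //; apply/integrableP; split.
  by apply/measurable_EFinP; exact: measurable_normc_sqr.
under eq_integral do rewrite gee0_abs ?lee_fin ?sqr_ge0//.
have mv N : measurable_fun (setT : set mR) (v N).
  apply: measurable_sum => k; apply: measurable_funM => //.
  apply: (@measurable_normc (fun t => g (t - _))).
  exact: measurable_cfun_shift.
have zint N : (\int[mu]_t (normc (z N t) ^+ 2)%:E <=
    (B * M * B)%:E * \int[mu]_t (normc (g t))%:E)%E.
  apply: (@le_trans _ _ (\int[mu]_t ((B * M)%:E * (v N t)%:E))%E).
    apply: ge0_le_integral => //.
    - by move=> t _; rewrite lee_fin sqr_ge0.
    - by apply/measurable_EFinP; exact: measurable_normc_sqr.
    - by apply/measurable_EFinP; apply: measurable_funM.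
    - move=> t _; rewrite -EFinM lee_fin.
      by rewrite expr2 ler_pM ?normc_ge0// (le_trans (zv N t)).
  rewrite ge0_integralZl_EFin//; first last.
  - by rewrite mulr_ge0.
  - exact/measurable_EFinP.
  - by move=> t _; rewrite lee_fin.
  rewrite (@integral_symsum_shift R (fun n => normc (b n)) (fun t => normc (g t)) N
    (fun n => normc_ge0 _) (fun t => normc_ge0 _) (measurable_normc mg)).
  rewrite muleA -EFinM; apply: lee_wpmul2r.
    by apply: integral_ge0 => t _; rewrite lee_fin normc_ge0.
  by rewrite lee_fin ler_wpM2l ?mulr_ge0//; exact: bB.
have := @fatou _ _ R mu setT measurableT (fun N t => (normc (z N t) ^+ 2)%:E).
have einfE t : limn_einf (fun N => (normc (z N t) ^+ 2)%:E) = (normc (pconv b g t) ^+ 2)%:E.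
  have cv : (normc (z N t) ^+ 2)%:E @[N --> \oo] --> (normc (pconv b g t) ^+ 2)%:E.
    apply/cvg_EFin; first exact: nearW.
    have /cvgC_ReIm[c1 c2] := zc t; rewrite normc_sqr.
    rewrite (_ : _ \o _ =
      (fun N => complex.Re (z N t) ^+ 2 + complex.Im (z N t) ^+ 2)); last first.
      by apply/funext => N /=; rewrite normc_sqr.
    by rewrite !expr2; apply: cvgD; exact: cvgM.
  by have [-> _] := cvg_limn_einf_sup cv.
under eq_integral do rewrite einfE.
move=> F; apply: le_lt_trans (F _ _) _.
- by move=> N; apply/measurable_EFinP; exact: measurable_normc_sqr.
- by move=> N t _; rewrite lee_fin sqr_ge0.
apply: (@le_lt_trans _ _ ((B * M * B)%:E * \int[mu]_t (normc (g t))%:E)%E).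
  rewrite limn_einf_lim; apply: lime_le; first exact: is_cvg_einfs.
  apply: nearW => N; apply: le_trans (zint N).
  by apply: ereal_inf_lbound; exists N => /=.
apply: lte_mul_pinfty => //; first by rewrite lee_fin !mulr_ge0.
move/integrableP : ig => [_].
by under eq_integral do rewrite gee0_abs ?lee_fin ?normc_ge0//.
Qed.

End SquareIntegrable.

(** * First variation and almost everywhere identities *)

Section Variation.
Variable R : realType.
Local Notation C := R[i].
Local Notation mu := (@lebesgue_measure R).
Local Notation mR := (measurableTypeR R).
Implicit Types (y g r : R -> C) (b : int -> C).

Lemma integrable_Re_conj (w : C) r g : sq_integrable r -> sq_integrable g ->
  mu.-integrable setT (fun t => (complex.Re (w * (r t * (g t)^*%C)))%:E).
Proof.
move=> [mr ir] [mg ig].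
have i2 : mu.-integrable setT
    (fun t => (normc w * normc (r t) ^+ 2 + normc w * normc (g t) ^+ 2)%:E).
  rewrite (_ : (fun _ => _) = (fun t => ((normc w)%:E * (normc (r t) ^+ 2)%:E) +
      ((normc w)%:E * (normc (g t) ^+ 2)%:E))%E).
    by apply: integrableD => //; exact: integrableZl.
  by apply/funext => t; rewrite EFinD !EFinM.
apply: le_integrable i2 => //.
  apply/measurable_EFinP.
  apply: (measurable_cfunM (measurable_cfun_cst w)
    (measurable_cfunM mr (measurable_cfun_conj mg))).1.
move=> t _; rewrite lee_fin [leRHS]ger0_norm; last first.
  by rewrite addr_ge0// mulr_ge0 ?normc_ge0 ?sqr_ge0.
rewrite (le_trans (ler_Re_normc _))// !normcM normc_conj -mulrDr.
rewrite ler_wpM2l ?normc_ge0//.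
have := normc_ge0 (r t); have := normc_ge0 (g t).
move: (normc (r t)) (normc (g t)) => u v v0 u0.
have := sqr_ge0 (u - v); have := mulr_ge0 u0 v0; rewrite !expr2; lra.
Qed.

Lemma normc_sqr_sub (c x y : C) (e : R) :
  normc (x - e%:C%C * c * y) ^+ 2 = normc x ^+ 2 +
   ((- 2 * e) * complex.Re (c^*%C * (x * y^*%C)) + (e ^+ 2 * normc c ^+ 2) * normc y ^+ 2).
Proof.
rewrite !normc_sqr; case: c => c1 c2; case: x => x1 x2; case: y => y1 y2 /=.
by rewrite !mul0r !subr0 !addr0; ring.
Qed.

Lemma first_variation (c : C) r g : sq_integrable r -> sq_integrable g ->
  (forall e : R, (\int[mu]_t (normc (r t) ^+ 2)%:E <=
      \int[mu]_t (normc (r t - e%:C%C * c * g t) ^+ 2)%:E)%E) ->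
  (\int[mu]_t (complex.Re (c^*%C * (r t * (g t)^*%C)))%:E = 0)%E.
Proof.
move=> sr sg rmin.
set X := fun t => complex.Re (c^*%C * (r t * (g t)^*%C)).
have iX : mu.-integrable setT (EFin \o X) := integrable_Re_conj c^*%C sr sg.
have ir := sr.2; have ig := sg.2.
pose IX := (\int[mu]_t X t)%R; pose IY := (\int[mu]_t normc (g t) ^+ 2)%R.
have IXE : (\int[mu]_t (X t)%:E = IX%:E)%E.
  by rewrite /IX /Rintegral fineK//; exact: integrable_fin_num.
rewrite IXE; congr (_%:E); set k := normc c ^+ 2.
have k0 : 0 <= k by exact: sqr_ge0.
have IY0 : 0 <= IY by apply: Rintegral_ge0 => t _; exact: sqr_ge0.
have main (e : R) : 0 <= (- 2 * e) * IX + (e ^+ 2 * k) * IY.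
  have i1 : mu.-integrable setT (EFin \o (fun t => (- 2 * e) * X t)).
    rewrite (_ : _ \o _ = (fun t => ((- 2 * e)%:E * (X t)%:E)%E))//.
    exact: integrableZl.
  have i2 : mu.-integrable setT (EFin \o (fun t => (e ^+ 2 * k) * normc (g t) ^+ 2)).
    rewrite (_ : _ \o _ = (fun t => ((e ^+ 2 * k)%:E * (normc (g t) ^+ 2)%:E)%E)) //.
    exact: integrableZl.
  have i3 : mu.-integrable setT (EFin \o
      (fun t => (- 2 * e) * X t + (e ^+ 2 * k) * normc (g t) ^+ 2)).
    rewrite (_ : _ \o _ = (fun t => ((- 2 * e) * X t)%:E +
      ((e ^+ 2 * k) * normc (g t) ^+ 2)%:E)%E)//.
    exact: integrableD.
  have := rmin e; under [X in (_ <= X)%E -> _]eq_integral do rewrite normc_sqr_sub EFinD.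
  rewrite integralD// -[leLHS]adde0 leeD2lE ?integrable_fin_num// => h.
  have := h; rewrite -[X in (_ <= X)%E]fineK ?integrable_fin_num// lee_fin.
  rewrite -[fine _]/(\int[mu]_t ((- 2 * e) * X t + (e ^+ 2 * k) * normc (g t) ^+ 2))%R.
  by rewrite RintegralD// !RintegralZl.
(* The minimum of the quadratic is at [IX / (k * IY)]. Adding 1 to the denominator avoids the case
   of a zero denominator and still gives a value that is negative unless [IX = 0]. *)
have := main (IX / (k * IY + 1)).
set d := k * IY + 1; have d0 : 0 < d by rewrite ltr_wpDl// mulr_ge0.
have -> : - 2 * (IX / d) * IX + (IX / d) ^+ 2 * k * IY =
    - (IX ^+ 2 * (d + 1) / d ^+ 2).
  by rewrite /d; field; rewrite -/d gt_eqF.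
rewrite oppr_ge0 => h; apply/eqP; rewrite -sqrf_eq0; apply/eqP/le_anti.
rewrite sqr_ge0 andbT.
by move: h; rewrite pmulr_lle0 ?invr_gt0 ?exprn_gt0// pmulr_lle0// addr_gt0.
Qed.

Lemma ae_zero_of_primitive (f : R -> R) (M : R) :
  mu.-integrable setT (EFin \o f) ->
  (forall x, x < M -> (\int[mu]_(t in `]-oo, x]) f t)%R = 0) ->
  {ae mu, forall x, x < M -> f x = 0}.
Proof.
move=> fi F0.
have li : locally_integrable setT f.
  by apply: open_integrable_locally => //; exact: openT.
have iy (u : R) : mu.-integrable `]-oo, u] (EFin \o f) by exact: integrableS fi.
have := FTC1Ny iy li; apply: filterS; first exact: (ae_filter_ringOfSetsType mu).
move=> x [_ fx] xM.
rewrite -fx derive1E.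
have -> : 'D_1 (fun y : R => (\int[mu]_(t in [set` `]-oo, y]]) f t)%R) x =
          'D_1 (cst 0 : R -> R) x.
  apply: near_eq_derive.
  near=> u; apply: F0; near: u; exact: lt_nbhsl.
by rewrite derive_cst.
Unshelve. all: by end_near. Qed.

End Variation.

(** * Adjointness of convolution with [b] and with [drev b] *)

Section CrossCorrelation.
Variable R : realType.
Local Notation C := R[i].
Local Notation mu := (@lebesgue_measure R).
Local Notation mR := (measurableTypeR R).

Lemma sq_integrableZ (c : C) (y : R -> C) : sq_integrable y ->
  sq_integrable (fun t => c * y t).
Proof.
move=> [my iy]; split; first exact: measurable_cfunM (measurable_cfun_cst c) my.
rewrite (_ : (fun _ => _) = (fun t => ((normc c ^+ 2)%:E * (normc (y t) ^+ 2)%:E)%E)).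
  exact: integrableZl.
by apply/funext => t; rewrite normcM exprMn EFinM.
Qed.

Lemma sq_integrable_shift (a : R) (y : R -> C) : sq_integrable y ->
  sq_integrable (fun t => y (t + a)).
Proof.
move=> [my iy]; split; first exact: measurable_cfun_shift.
exact: (integrable_shift a iy).
Qed.

Lemma measurable_step (A : set mR) : measurable A -> measurable_cfun (step 1 A).
Proof.
move=> mA; split.
  by under eq_fun do rewrite Re_step; apply: measurable_funM.
by under eq_fun do rewrite Im_step; apply: measurable_funM.
Qed.

Lemma normc_step1 (A : set mR) (t : R) : normc (step (1 : C) A t) = \1_A t.
Proof. by rewrite /step mul1r normc_real ger0_norm. Qed.

Lemma sqr_indic (A : set mR) (t : R) : (\1_A t : R) ^+ 2 = \1_A t.
Proof. by rewrite indicE; case: (_ \in _); rewrite ?expr1n ?expr0n. Qed.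

Lemma sq_integrable_step (A : set mR) : measurable A -> (mu A < +oo)%E ->
  sq_integrable (step 1 A).
Proof.
move=> mA Aoo; split; first exact: measurable_step.
rewrite (_ : (fun _ => _) = (fun t => (\1_A t)%:E)); first exact: integrable_indic_lty.
by apply/funext => t; rewrite normc_step1 sqr_indic.
Qed.

Variables (b : int -> C) (r : R -> C) (m : nat).
Hypotheses (sb : summable_seq b) (sr : sq_integrable r).

Let S N t : C := zpartial (fun n => drev b n * r (t - n%:~R)) N.

Lemma zpartial_drevE N t : S N t = symsum (fun n => (b n)^*%C * r (t + n%:~R)) N.
Proof.
rewrite /S -(zpartial_oppr (fun n => drev b n * r (t - n%:~R))); apply: eq_symsum => n.
by rewrite /drev opprK rmorphN opprK.
Qed.

Lemma measurable_zpartial_drev N : measurable_cfun (S N).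
Proof.
apply: (@measurable_cfun_symsum _ (fun n t => drev b n * r (t - n%:~R)) N) => n.
apply: measurable_cfunM; first exact: measurable_cfun_cst.
by apply: measurable_cfun_shift; exact: sr.1.
Qed.

Let ReM_symsum (w : C) (f : int -> C) N :
  complex.Re (w * symsum f N) = symsum (fun n => complex.Re (w * f n)) N.
Proof.
rewrite (symsum_morph (f := fun z : C => complex.Re (w * z)))//.
  by rewrite mulr0.
by move=> x y; rewrite mulrDr Re_add.
Qed.

Lemma integral_symsum (F : int -> R -> R) N :
  (forall n, mu.-integrable setT (fun t => (F n t)%:E)) ->
  (\int[mu]_t (symsum (F^~ t) N)%:E =
   \sum_(k < N.*2.+1) \int[mu]_t (F (k%:Z - N%:Z) t)%:E)%E.
Proof.
move=> iF; under eq_integral do rewrite /symsum -sumEFin.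
by rewrite integral_sum.
Qed.

(** Translating the [n]-th term by [n] takes the shift off the step and puts it on [r]. At the level
    of partial sums only finitely many integrals are exchanged. *)
Lemma integral_swap (w : C) (A : set mR) N : measurable A -> (mu A < +oo)%E ->
  (\int[mu]_t (complex.Re (w * S N t) * \1_A t)%:E =
   \int[mu]_t (complex.Re (w * (r t *
      (zpartial (fun n => b n * step 1 A ((t : R) - n%:~R)) N)^*%C)))%:E)%E.
Proof.
move=> mA Aoo.
pose F n (t : R) := complex.Re (w * (r t * (b n * step 1 A (t - n%:~R))^*%C)).
have iF n : mu.-integrable setT (fun t => (F n t)%:E).
  apply: integrable_Re_conj => //.
  by apply: sq_integrableZ; apply: sq_integrable_shift; exact: sq_integrable_step.
have iFs n : mu.-integrable setT (fun t : R => (F n (t + n%:~R))%:E).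
  exact: (integrable_shift n%:~R (iF n)).
transitivity (\int[mu]_t (symsum (fun n => F n ((t : R) + n%:~R)) N)%:E)%E.
  apply: eq_integral => t _; congr (_%:E).
  rewrite zpartial_drevE ReM_symsum -symsumMr; apply: eq_symsum => n; rewrite /F ?addrK.
  have -> : (b n * step 1 A t)^*%C = (b n)^*%C * (\1_A t)%:C%C.
    by rewrite /step mul1r rmorphM; congr (_ * _); exact: conjc_real.
  have -> : w * (r (t + n%:~R) * ((b n)^*%C * (\1_A t)%:C%C)) =
    (w * ((b n)^*%C * r (t + n%:~R))) * (\1_A t)%:C%C by ring.
  by rewrite [in RHS]Re_mul/= mulr0 subr0.
rewrite (integral_symsum (F := fun n t => F n (t + n%:~R)))//.
transitivity (\int[mu]_t (symsum (F^~ t) N)%:E)%E.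
  rewrite integral_symsum//; apply: eq_bigr => k _.
  exact: (integral_shift (k%:Z - N%:Z)%:~R (iF _)).
apply: eq_integral => t _; congr (_%:E); rewrite /zpartial rmorph_sum/= mulr_sumr.
by rewrite -[in RHS]/(symsum (fun n =>
  r t * (b n * step 1 A ((t : R) - n%:~R))^*%C) N) ReM_symsum.
Qed.

Lemma integral_swap_cvg (w : C) (A : set mR) : measurable A -> (mu A < +oo)%E ->
  A `<=` `]0, m.+1%:R[ ->
  (\int[mu]_t (complex.Re (w * S N t) * \1_A t)%:E)%E @[N --> \oo] -->
  (\int[mu]_t (complex.Re (w * (r t * (pconv b (step 1 A) t)^*%C)))%:E)%E.
Proof.
move=> mA Aoo AI.
have sA0 t : ~ (0 < t < m.+1%:R) -> step 1 A t = 0 :> C.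
  by move=> t0; apply: step_notin => /AI; rewrite /= in_itv.
have sAi : mu.-integrable setT (fun t => (normc (step 1 A t))%:E).
  under eq_fun do rewrite normc_step1; exact: integrable_indic_lty.
have sA1 t : normc (step (1 : C) A t) <= 1.
  by rewrite (le_trans (normc_step_le _ _ _))// normc1.
have msA := measurable_step mA.
(* Convolving the step with the moduli of [b] gives a square integrable bound for all partial sums
   at once, hence an integrable majorant for their products with [r]. *)
pose b' n : C := (normc (b n))%:C%C.
have sb' : summable_seq b'.
  by apply: summable_le sb => n; rewrite normc_real ger0_norm ?normc_ge0.
have sg := pconv_sq_integrable sb sA0 msA sA1 sAi.
have sg' := pconv_sq_integrable sb' sA0 msA sA1 sAi.
pose z N t : C := zpartial (fun n => b n * step 1 A (t - n%:~R)) N.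
pose u t N : R := symsum (fun n => normc (b n) * \1_A (t - n%:~R)) N.
have u0 t n : 0 <= normc (b n) * \1_A (t - n%:~R) by rewrite mulr_ge0 ?normc_ge0.
have zu N t : normc (z N t) <= u t N.
  rewrite (le_trans (ler_normc_sum _ _ _))//; apply: ler_sum => k _.
  by rewrite normcM normc_step1.
have uc t : u t @ \oo --> complex.Re (pconv b' (step 1 A) t).
  have /cvgC_ReIm[+ _] := pconv_cvg (b := b') (t := t) sA0.
  rewrite [X in X @ _ --> _ -> _](_ : _ = u t)//; apply/funext => N.
  rewrite symsumE (symsum_morph (f := @complex.Re R))//; last exact: Re_add.
  apply: eq_symsum => n.
  rewrite -[LHS]/(complex.Re (b' n * step 1 A (t - n%:~R))) Re_mul Re_step Im_step.
  by rewrite /b'/= !mul0r mul1r subr0.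
have uN N t : u t N <= normc (pconv b' (step 1 A) t).
  apply: le_trans (le_trans (ler_norm _) (ler_Re_normc _)).
  rewrite -(cvg_lim (@Rhausdorff R) (uc t)).
  apply: nondecreasing_cvgn_le; last by apply/cvg_ex; eexists; exact: uc.
  exact: nondecreasing_symsum.
under eq_fun do rewrite integral_swap//.
have mf N : measurable_fun (setT : set mR)
    (fun t => (complex.Re (w * (r t * (z N t)^*%C)))%:E).
  apply/measurable_EFinP.
  apply: (measurable_cfunM (measurable_cfun_cst w)
    (measurable_cfunM sr.1 (measurable_cfun_conj _))).1.
  apply: (@measurable_cfun_symsum _ (fun n t => b n * step 1 A (t - n%:~R)) N) => n.
  apply: measurable_cfunM; first exact: measurable_cfun_cst.
  exact: measurable_cfun_shift.
have ig : mu.-integrable setT (fun t =>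
    (normc w * normc (r t) ^+ 2 + normc w * normc (pconv b' (step 1 A) t) ^+ 2)%:E).
  rewrite (_ : (fun _ => _) = (fun t => ((normc w)%:E * (normc (r t) ^+ 2)%:E) +
      ((normc w)%:E * (normc (pconv b' (step 1 A) t) ^+ 2)%:E))%E).
    by apply: integrableD => //; apply: integrableZl => //; [exact: sr.2|exact: sg'.2].
  by apply/funext => t; rewrite EFinD !EFinM.
have [] := @dominated_convergence _ _ R mu setT measurableT
  (fun N t => (complex.Re (w * (r t * (z N t)^*%C)))%:E)
  (fun t => (complex.Re (w * (r t * (pconv b (step 1 A) t)^*%C)))%:E) _ mf _ _ ig.
- by have /integrableP[] := integrable_Re_conj w sr sg.
- apply: aeW => t _; apply/cvg_EFin; first exact: nearW.
  have /cvgC_ReIm[cr ci] := pconv_cvg (b := b) (t := t) sA0.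
  have ReE (q : C) : complex.Re (w * (r t * q^*%C)) =
      complex.Re (w * r t) * complex.Re q + complex.Im (w * r t) * complex.Im q.
    by rewrite mulrA Re_mul Re_conjc Im_conjc mulrN opprK.
  rewrite ReE (_ : _ \o _ = (fun N => complex.Re (w * r t) * complex.Re (z N t) +
      complex.Im (w * r t) * complex.Im (z N t))).
    by apply: cvgD; apply: cvgMl_tmp.
  by apply/funext => N; rewrite /= ReE.
- apply: aeW => t N _; rewrite lee_fin.
  rewrite (le_trans (ler_Re_normc _))// !normcM normc_conj -mulrDr.
  rewrite ler_wpM2l ?normc_ge0//.
  have := le_trans (zu N t) (uN N t); have := normc_ge0 (z N t); have := normc_ge0 (r t).
  move: (normc (r t)) (normc (z N t)) (normc (pconv _ _ _)) => x1 x2 x3 x10 x20 x23.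
  have := ler_wpM2l x10 x23.
  have := sqr_ge0 (x1 - x3); have := mulr_ge0 x10 (le_trans x20 x23); rewrite !expr2; lra.
- by [].
Qed.

End CrossCorrelation.

(** * Almost everywhere vanishing of the cross-correlation series *)

Section AlmostEverywhere.
Variable R : realType.
Local Notation C := R[i].
Local Notation mu := (@lebesgue_measure R).
Local Notation mR := (measurableTypeR R).

Variables (b : int -> C) (r : R -> C) (m : nat).
Hypotheses (sb : summable_seq b) (sr : sq_integrable r).

Let S N t : C := zpartial (fun n => drev b n * r (t - n%:~R)) N.
Let A0 : set mR := punctured_itv m m.+1%:R.
Let mA0 : measurable A0 := measurable_punctured_itv m m.+1%:R.
Let A0oo : (mu A0 < +oo)%E := punctured_itv_lty m m.+1%:R.

Let Tn N (t : R) : R := symsum (fun n => normc (b n) * normc (r (t + n%:~R))) N * \1_A0 t.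

Let Tn0 N t : 0 <= Tn N t.
Proof.
by rewrite mulr_ge0//; apply: symsum_ge0 => n; rewrite mulr_ge0 ?normc_ge0.
Qed.

Let Tn_nd t : nondecreasing_seq (Tn^~ t).
Proof.
move=> i j ij; rewrite ler_wpM2r//; apply: nondecreasing_symsum => // n.
by rewrite mulr_ge0 ?normc_ge0.
Qed.

Let mTn N : measurable_fun (setT : set mR) (Tn N).
Proof.
apply: measurable_funM => //.
apply: measurable_sum => k; apply: measurable_funM => //.
apply: (@measurable_normc _ (fun t => r (t + _))).
by apply: measurable_cfun_shift; exact: sr.1.
Qed.

(** [r] is square integrable but possibly not integrable, whence the bound of [|r|] by [1 + |r|^2].
    The constant is integrated over [A0], of finite measure, and the squares over the whole line,
    where translations do not matter. *)
Let Tn_int : exists K : R, forall N, (\int[mu]_t (Tn N t)%:E <= K%:E)%E.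
Proof.
have [B bB] := sb.
have B0 : 0 <= B by rewrite (le_trans _ (bB 0%N))// symsum0 normc_ge0.
have [mr ir] := sr.
pose I2 := fine (\int[mu]_t (normc (r t) ^+ 2)%:E).
have I2E : (\int[mu]_t (normc (r t) ^+ 2)%:E = I2%:E)%E.
  by rewrite /I2 fineK//; exact: integrable_fin_num.
have I20 : 0 <= I2.
  by rewrite -lee_fin -I2E; apply: integral_ge0 => t _; rewrite lee_fin sqr_ge0.
exists (B * (fine (mu A0) + I2)) => N.
(* The index is reflected to match the form required by [integral_symsum_shift]. *)
pose U (t : R) := symsum (fun n => normc (b (- n)) * normc (r (t - n%:~R)) ^+ 2) N.
have mU : measurable_fun (setT : set mR) U.
  apply: measurable_sum => k; apply: measurable_funM => //.
  apply: (@measurable_normc_sqr _ (fun t => r (t - _))).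
  exact: measurable_cfun_shift.
have U0 t : 0 <= U t.
  by apply: symsum_ge0 => n; rewrite mulr_ge0 ?normc_ge0 ?sqr_ge0.
apply: (@le_trans _ _ (\int[mu]_t (B%:E * (\1_A0 t)%:E + (U t)%:E))%E).
  apply: ge0_le_integral => //.
  - by move=> t _; rewrite lee_fin.
  - exact/measurable_EFinP.
  - apply: emeasurable_funD; last exact/measurable_EFinP.
    by apply/measurable_EFinP; exact: measurable_funM.
  - move=> t _; rewrite -EFinM -EFinD lee_fin /Tn.
    have UE : U t = symsum (fun n => normc (b n) * normc (r (t + n%:~R)) ^+ 2) N.
      rewrite -[RHS]symsum_oppr; apply: eq_symsum => n.
      by rewrite rmorphN.
    have [At|At] := boolP (t \in A0); last first.
      by rewrite indicE (negbTE At) !mulr0 add0r.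
    rewrite indicE At !mulr1 UE (@le_trans _ _ (symsum (fun n =>
      normc (b n) + normc (b n) * normc (r (t + n%:~R)) ^+ 2) N))//.
      apply: ler_symsum => n; rewrite -{2}[normc (b n)]mulr1 -mulrDr ler_wpM2l ?normc_ge0//.
      have := sqr_ge0 (normc (r (t + n%:~R)) - 1); have := normc_ge0 (r (t + n%:~R)).
      move: (normc _) => x x0; rewrite !expr2; lra.
    by rewrite symsumD lerD2r; exact: bB.
have mI : measurable_fun (setT : set mR) (fun t => (B%:E * (\1_A0 t)%:E)%E).
  by apply/measurable_EFinP; exact: measurable_funM.
have I0 (t : mR) : setT t -> (0 <= B%:E * (\1_A0 t)%:E)%E.
  by move=> _; rewrite -EFinM lee_fin mulr_ge0.
have mUE : measurable_fun (setT : set mR) (fun t => (U t)%:E) by exact/measurable_EFinP.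
rewrite (ge0_integralD mu measurableT I0 mI _ mUE); last by move=> t _; rewrite lee_fin.
rewrite ge0_integralZl_EFin//; last exact/measurable_EFinP.
rewrite integral_indic// setIT.
have -> : (\int[mu]_t (U t)%:E = (symsum (fun n => normc (b (- n))) N)%:E * I2%:E)%E.
  rewrite -I2E; apply: (@integral_symsum_shift R (fun n => normc (b (- n)))
    (fun t => normc (r t) ^+ 2) N).
  - by move=> n; exact: normc_ge0.
  - by move=> t; exact: sqr_ge0.
  - exact: measurable_normc_sqr.
rewrite -[X in (_ * X + _)%E]fineK ?ge0_fin_numE// -!EFinM -EFinD lee_fin mulrDr lerD2l.
by rewrite ler_wpM2r// (symsum_oppr (normc \o b)); exact: bB.
Qed.

(** It serves twice: integrability makes it finite almost everywhere, which is absolute convergence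
    of the series on [A0], and it dominates the partial sums in [f_restrict]. *)
Let T (t : R) : \bar R := limn (fun N => (Tn N t)%:E).

Let Tn_le N t : ((Tn N t)%:E <= T t)%E.
Proof.
apply: lime_ge; last by exists N => // k /= Nk; rewrite lee_fin; exact: Tn_nd.
by apply: ereal_nondecreasing_is_cvgn => i j ij; rewrite lee_fin; exact: Tn_nd.
Qed.

Let T_integrable : mu.-integrable setT T.
Proof.
have [K TK] := Tn_int.
have Tc t : (Tn N t)%:E @[N --> \oo] --> T t.
  apply: ereal_nondecreasing_is_cvgn => i j ij; rewrite lee_fin; exact: Tn_nd.
apply/integrableP; split.
  apply: (emeasurable_fun_cvg (fun N t => (Tn N t)%:E)) => [N|t _].
    apply/measurable_EFinP; exact: mTn.
  exact: Tc.
under eq_integral.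
  move=> t _; rewrite gee0_abs; first over.
  by apply: le_trans (Tn_le 0 t); rewrite lee_fin.
rewrite monotone_convergence//.
- apply: (@le_lt_trans _ _ K%:E); last exact: ltry.
  apply: lime_le; last exact: nearW.
  apply: ereal_nondecreasing_is_cvgn => i j ij; apply: ge0_le_integral => //.
  + by move=> t _; rewrite lee_fin.
  + apply/measurable_EFinP; exact: mTn.
  + apply/measurable_EFinP; exact: mTn.
  + by move=> t _; rewrite lee_fin; exact: Tn_nd.
- by move=> N; apply/measurable_EFinP; exact: mTn.
- by move=> N t _; rewrite lee_fin.
- by move=> t _ i j ij; rewrite lee_fin; exact: Tn_nd.
Qed.

Lemma ae_summable :
  {ae mu, forall t, A0 t -> summable_seq (fun n => drev b n * r (t - n%:~R))}.
Proof.
have := integrable_ae measurableT T_integrable.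
apply: filterS.
move=> t /(_ Logic.I) Tfin At; exists (fine (T t)) => N.
rewrite -lee_fin fineK//; apply: le_trans (Tn_le N t); rewrite lee_fin /Tn.
rewrite indicE mem_set// mulr1 -[leRHS]symsum_oppr le_eqVlt; apply/orP; left; apply/eqP.
by apply: eq_symsum => n /=; rewrite normcM normc_conj rmorphN.
Qed.

(* The upper limit makes [f w] measurable; it is the limit of [Re (w * S N t)]
   wherever the series converges absolutely. *)
Let f (w : C) (t : R) : R :=
  fine (limn_esup (fun N => (complex.Re (w * S N t))%:E)) * \1_A0 t.

Let mf w : measurable_fun (setT : set mR) (f w).
Proof.
apply: measurable_funM => //.
apply: measurableT_comp; first exact: fine_measurable.
apply: measurable_fun_limn_esup => N; apply/measurable_EFinP.
by apply: (measurable_cfunM (measurable_cfun_cst w) (measurable_zpartial_drev _ sr N)).1.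
Qed.

Let fE w t : A0 t -> summable_seq (fun n => drev b n * r (t - n%:~R)) ->
  f w t = complex.Re (w * zsum (fun n => drev b n * r (t - n%:~R))) /\
  complex.Re (w * S N t) @[N --> \oo] --> f w t.
Proof.
move=> At st; have /cvgC_ReIm[cr ci] := summable_zsum st.
set l := zsum _ in cr ci *.
have cw : complex.Re (w * S N t) @[N --> \oo] --> complex.Re (w * l).
  rewrite Re_mul; under eq_fun do rewrite Re_mul.
  by apply: cvgB; apply: cvgMl_tmp.
suff -> : f w t = complex.Re (w * l) by [].
rewrite /f indicE mem_set// mulr1.
have c : (complex.Re (w * S N t))%:E @[N --> \oo] --> (complex.Re (w * l))%:E.
  by apply/cvg_EFin => //; exact: nearW.
by have [_ ->] := cvg_limn_einf_sup c.
Qed.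

Hypothesis orth : forall (x : R) (w : C), x <= m.+1%:R ->
  (\int[mu]_t (complex.Re (w * (r t *
     (pconv b (step 1 (punctured_itv m x)) t)^*%C)))%:E = 0)%E.

Let sub_A0 x : x <= m.+1%:R -> punctured_itv m x `<=` A0.
Proof.
move=> xm t [tx nt]; split=> //; move: tx => /=; rewrite !in_itv/=.
by move=> /andP[-> tx]; exact: lt_le_trans xm.
Qed.

(** The integrals of [Re (w * S N)] over the punctured interval have two limits: 0, by
    [integral_swap_cvg] and orthogonality, and the integral of [f w], by dominated convergence. *)
Let f_restrict w x : x <= m.+1%:R ->
  mu.-integrable setT (fun t => (f w t * \1_(punctured_itv m x) t)%:E) /\
  (\int[mu]_t (f w t * \1_(punctured_itv m x) t)%:E = 0)%E.
Proof.
move=> xm; set A := punctured_itv m x.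
have mA : measurable (A : set mR) := measurable_punctured_itv m x.
have Aoo : (mu A < +oo)%E := punctured_itv_lty m x.
have AI : A `<=` `]0, m.+1%:R[ by move=> t /(sub_A0 xm)[].
have swap := @integral_swap_cvg R b r m sb sr w A mA Aoo AI.
rewrite orth// in swap.
have [|||||i _ c] := @dominated_convergence _ _ R mu setT measurableT
  (fun N t => (complex.Re (w * S N t) * \1_A t)%:E)
  (fun t => (f w t * \1_A t)%:E) (fun t => ((normc w)%:E * T t)%E).
- move=> N; apply/measurable_EFinP; apply: measurable_funM => //.
  by apply: (measurable_cfunM (measurable_cfun_cst w) (measurable_zpartial_drev _ sr N)).1.
- by apply/measurable_EFinP; exact: measurable_funM.
- apply: filterS ae_summable.
  move=> t st _; apply/cvg_EFin; first exact: nearW.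
  have [At|At] := boolP (t \in A); last first.
    rewrite /comp/= indicE (negbTE At) mulr0.
    by under eq_fun do rewrite mulr0; exact: cvg_cst.
  have A0t : A0 t by apply: sub_A0 xm _ _; exact: set_mem.
  by apply: cvgMr_tmp; exact: (fE w A0t (st A0t)).2.
- exact: integrableZl T_integrable.
- apply: aeW => t N _.
  apply: (@le_trans _ _ ((normc w)%:E * (Tn N t)%:E)%E); last first.
    by apply: lee_wpmul2l; rewrite ?lee_fin ?normc_ge0.
  rewrite -EFinM lee_fin normrM (ger0_norm (_ : 0 <= \1_A t))//.
  apply: (@le_trans _ _ (normc w * normc (S N t) * \1_A t)).
    by rewrite ler_wpM2r// -normcM ler_Re_normc.
  rewrite -mulrA ler_wpM2l ?normc_ge0// /Tn ler_pM ?normc_ge0//.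
    rewrite /S zpartial_drevE (le_trans (ler_normc_sum _ _ _))//.
    by apply: ler_sum => k _; rewrite normcM normc_conj.
  rewrite !indicE ler_nat; case: (boolP (t \in A)) => //= At.
  by rewrite mem_set//; apply: sub_A0 xm _ _; exact: set_mem.
split=> //; apply: (cvg_unique _ c swap); exact: ereal_hausdorff.
Qed.

(** The indicator built into [f w] vanishes off [A0], so the primitive started at minus infinity is
    the integral over [punctured_itv m x], up to the end point [x]. *)
Let f_primitive w x : x < m.+1%:R -> (\int[mu]_(t in `]-oo, x]) f w t)%R = 0.
Proof.
move=> xm.
have fi : mu.-integrable setT (EFin \o f w).
  have [+ _] := f_restrict w (lexx m.+1%:R).
  congr (_.-integrable _ _); apply/funext => t /=; congr (_%:E).
  rewrite /f -mulrA; congr (_ * _).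
  by rewrite -expr2 sqr_indic.
rewrite -Rintegral_itv_bndo_bndc; last by exact: integrableS fi.
rewrite Rintegral_mkcond /Rintegral.
have [_ H] := f_restrict w (ltW xm).
rewrite -[RHS]/(fine 0%E) -H; congr fine; apply: eq_integral => t _; congr (_%:E).
rewrite patchE /f !indicE -mulrA -natrM mulnb.
case: (boolP (t \in `]-oo, x[%classic)) => tx.
  congr (_ * (nat_of_bool _)%:R); rewrite andbC; apply/idP/andP => [/set_mem At|[]//].
  split; rewrite mem_set//; move: At => [At nt]; split=> //.
  have tx' : t < x by move: tx; rewrite inE/= in_itv.
  by move: At; rewrite /= !in_itv/= tx' => /andP[-> _].
case: (boolP (t \in punctured_itv m x)) => [/set_mem[/= At _]|_]; last by rewrite andbF mulr0.
by move: tx; rewrite notin_setE => tx; case: tx; move: At; rewrite /= !in_itv/= => /andP[_ ->].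
Qed.

Theorem ae_cross_correlation_cvg0 :
  {ae mu, forall t, A0 t ->
    zpartial (fun n => drev b n * r (t - n%:~R)) @ \oo --> (0 : C^o)}.
Proof.
have fi w : mu.-integrable setT (EFin \o f w).
  have [+ _] := f_restrict w (lexx m.+1%:R).
  congr (_.-integrable _ _); apply/funext => t /=; congr (_%:E).
  rewrite /f -mulrA; congr (_ * _).
  by rewrite -expr2 sqr_indic.
have F := ae_filter_ringOfSetsType mu.
(* Weight 1 yields the real part of the sum; weight -i yields its imaginary part. *)
apply: filterS3 ae_summable (ae_zero_of_primitive (fi 1) (@f_primitive 1))
  (ae_zero_of_primitive (fi (-'i)%C) (@f_primitive (-'i)%C)) => t st f1 fi0 At.
have tm : t < m.+1%:R by move: At => [/=]; rewrite in_itv/= => /andP[].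
have := summable_zsum (st At).
suff -> : zsum (fun n => drev b n * r (t - n%:~R)) = 0 by [].
have := (fE 1 At (st At)).1; have := (fE (-'i)%C At (st At)).1.
rewrite f1// fi0// mul1r Re_mul/=; case: (zsum _) => u v /=.
by rewrite oppr0 mul0r sub0r mulN1r opprK => <- <-.
Qed.

End AlmostEverywhere.

(** * Minimisers *)

Section Minimisers.
Variable R : realType.
Local Notation C := R[i].
Local Notation mu := (@lebesgue_measure R).
Local Notation mR := (measurableTypeR R).
Implicit Types (a b : int -> C) (y g h : R -> C).

Lemma class_D_measurable y : class_D y -> measurable_cfun y.
Proof.
by move=> [_ _ [/integrableP[mr _] /integrableP[mi _]] _]; split; exact/measurable_EFinP.
Qed.

Lemma class_D_integrable_normc y : class_D y ->
  mu.-integrable setT (fun t => (normc (y t))%:E).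
Proof.
move=> yD; have [_ _ [ir ii] _] := yD.
have i2 : mu.-integrable setT
    (fun t => (`|complex.Re (y t)| + `|complex.Im (y t)|)%:E).
  rewrite (_ : (fun _ => _) =
    (fun t => (`|(complex.Re (y t))%:E| + `|(complex.Im (y t))%:E|)%E))//.
  by apply: integrableD => //; exact: integrable_abse.
apply: le_integrable i2 => //.
  by apply/measurable_EFinP; apply: measurable_normc; exact: class_D_measurable.
move=> t _; rewrite lee_fin [leLHS]ger0_norm ?normc_ge0// [leRHS]ger0_norm ?addr_ge0//.
exact: ler_normc_ReIm.
Qed.

Lemma pconv_add b y g (m : nat) (c : C) t :
  (forall t, ~ (0 < t < m.+1%:R) -> y t = 0) ->
  (forall t, ~ (0 < t < m.+1%:R) -> g t = 0) ->
  pconv b (fun u => y u + c * g u) t = pconv b y t + c * pconv b g t.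
Proof.
move=> y0 g0; rewrite !(@pconv_fin R m)//; last first.
  by move=> u u0; rewrite y0// g0// mulr0 addr0.
rewrite mulr_sumr -big_split/=; apply: eq_bigr => j _.
by rewrite mulrDr mulrCA.
Qed.

Lemma chi_samples (m : nat) a y :
  (forall n : int, n <= 0 \/ m.+1%:Z <= n -> a n = 0) -> chi m a y -> samples y = a.
Proof.
move=> a0 [_ ya y0]; apply/funext => -[n|n]; rewrite /samples.
  by rewrite -ya.
rewrite [RHS]a0; last by left; rewrite NegzE; lia.
by apply: y0; rewrite NegzE rmorphN/= oppr_gt0 ltNge ler0n.
Qed.

(** If the values at [t] were distinct, each function would move by less than half the gap near [t],
    so the two would differ on a whole ball, which has positive measure. *)
Lemma ae_eq_continuous (f g : R -> C^o) (u v t : R) :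
  {ae mu, forall s, u < s < v -> f s = g s} -> u < t < v ->
  {for t, continuous f} -> {for t, continuous g} -> f t = g t.
Proof.
move=> [N [mN N0 fgN]] /andP[ut tv] /cvg_normcP fc /cvg_normcP gc.
apply: contrapT => fgt.
pose d := normc ((f t : C) - g t).
have d0 : 0 < d.
  rewrite lt_neqAle normc_ge0 andbT eq_sym; apply/eqP => /eq0_normc/eqP.
  by rewrite subr_eq0 => /eqP.
have d20 : 0 < d / 2 by rewrite divr_gt0.
have /nbhs_ballP[e /= e0 be] : \forall s \near t, N s.
  near=> s; apply: fgN => /=; apply/not_implyP; split.
    by apply/andP; split; near: s; [exact: lt_nbhsr|exact: lt_nbhsl].
  move=> fgs.
  have h1 : normc ((f s : C) - f t) < d / 2.
    have : `|0 - normc ((f s : C) - f t)| < d / 2.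
      by near: s; move/cvgrPdist_lt : fc; exact.
    by rewrite sub0r normrN ger0_norm ?normc_ge0.
  have h2 : normc ((g s : C) - g t) < d / 2.
    have : `|0 - normc ((g s : C) - g t)| < d / 2.
      by near: s; move/cvgrPdist_lt : gc; exact.
    by rewrite sub0r normrN ger0_norm ?normc_ge0.
  have := ler_normcD ((f t : C) - f s) ((g s : C) - g t).
  move: h1; rewrite fgs addrA subrK -/d [normc (f t - _)]normc_dist => h1; lra.
have : (mu (ball t e) <= mu N)%E.
  by apply: le_measure; rewrite ?inE//; exact: measurable_ball.
rewrite N0 lebesgue_measure_ball; last exact: ltW.
by rewrite lee_fin leNgt mulrn_wgt0.
Unshelve. all: by end_near. Qed.

End Minimisers.

Unset Implicit Arguments.
Set Strict Implicit.

(** Minimality in L^2 sees signals only up to null sets. Equality at a given point therefore rests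
    on something that fixes the values there: interpolation at the integers, continuity
    elsewhere. *)
Theorem corollary2 (R : realType) (m : nat) (h : R -> R[i])
    (rho_d : int -> R[i]) (rho : R -> R[i]) :
  (0 < m)%N ->
  in_L2 h ->
  interpolation h ->
  proper_signal rho_d ->
  (forall n : int, n <= 0 \/ m.+1%:Z <= n -> rho_d n = 0) ->
  is_argmin (chi m rho_d) (fun y => L2norm (fun t => h t - yhat y t)) rho ->
  let lhs := pconv (dconv (conv_inv rho_d) (conv_inv (drev rho_d))) rho in
  let rhs := pconv (conv_inv (drev rho_d)) h in
  {ae @lebesgue_measure R, forall t, 0 < t < m.+1%:R -> lhs t = rhs t} /\
  (forall t, 0 < t < m.+1%:R ->
     (exists n : int, t = n%:~R) \/
     ({for t, continuous (lhs : R -> R[i]^o)} /\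
      {for t, continuous (rhs : R -> R[i]^o)}) ->
     lhs t = rhs t).
Proof.
move=> _ hL2 hint ap a0 [rhochi rhomin] lhs rhs.
have a0' k : ~~ (0 <= k <= m%:Z) -> rho_d k = 0 by move=> km; apply: a0; lia.
have [bb ab] := conv_invE ap.
have sb := conv_inv_summable a0' ap.
set b := conv_inv rho_d in bb ab sb.
have yhatE y : chi m rho_d y -> yhat y = pconv b y.
  by move=> yc; rewrite /yhat (chi_samples a0 yc).
have [rhoD rhon rho0] := rhochi.
have rhos := chi_samples a0 rhochi.
have [_ _ _ [M rhoM]] := rhoD.
have srho : sq_integrable (pconv b rho).
  apply: (pconv_sq_integrable sb rho0) rhoM _; first exact: class_D_measurable.
  exact: class_D_integrable_normc.
pose r t := h t - pconv b rho t.
have sr : sq_integrable r by apply: sq_integrableB => //; exact: in_L2_sq_integrable.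
have orth (x : R) (w : R[i]) : x <= m.+1%:R ->
    (\int[lebesgue_measure]_t (complex.Re (w * (r t *
     (pconv b (step 1 (punctured_itv m x)) t)^*%C)))%:E = 0)%E.
  move=> xm; set A := punctured_itv m x.
  have mA : measurable (A : set (measurableTypeR R)) := measurable_punctured_itv m x.
  have Aoo := punctured_itv_lty m x.
  have s0 t : ~ (0 < t < m.+1%:R) -> step 1 A t = 0 :> R[i].
    move=> t0; apply: step_notin => -[/=]; rewrite in_itv/= => /andP[t1 t2] _.
    by apply: t0; rewrite t1 (lt_le_trans t2).
  have sg : sq_integrable (pconv b (step 1 A)).
    apply: (pconv_sq_integrable sb s0 (M := 1)).
    - exact: measurable_step.
    - by move=> t; rewrite (le_trans (normc_step_le _ _ _))// normc1.
    - by under eq_fun do rewrite normc_step1; exact: integrable_indic_lty.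
  (* The first variation along [c] carries the weight [c^*], so the competitor is [rho] plus
     [e * w^*] times the step. *)
  rewrite -[w]conjcK; apply: first_variation => // e.
  have yc := chi_step (e%:C%C * w^*%C) xm rhochi.
  apply: L2norm_le_int; have := rhomin _ yc; rewrite !yhatE//.
  congr (_ <= L2norm _)%E; apply/funext => t; rewrite /r -addrA -opprD; congr (_ - _).
  have := pconv_add b (e%:C%C * w^*%C) t rho0 s0.
  rewrite (_ : (fun u => _) = (fun u => rho u + step (e%:C%C * w^*%C) A u)) => [->//|].
  by apply/funext => u; rewrite /step mul1r.
have eqS t : zpartial (fun n => drev b n * r (t - n%:~R)) @ \oo --> (0 : R[i]^o) ->
    lhs t = rhs t.
  move=> S0; rewrite /lhs /rhs conv_inv_drev//.
  by apply/esym; exact: (pconv_drev_eq rho0 bb sb).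
have eqint (n : int) : lhs n%:~R = rhs n%:~R.
  apply: eqS; rewrite (_ : (fun _ => _) = (fun=> 0)).
    rewrite (_ : zpartial _ = cst 0); first exact: cvg_cst.
    by apply/funext => N; rewrite /zpartial big1.
  apply/funext => k; rewrite /r -rmorphB/= (pconv_conv_inv_int _ a0' ap rhos).
  by rewrite -[h _]/(samples h (n - k)) hint subrr mulr0.
have ae : {ae @lebesgue_measure R, forall t, 0 < t < m.+1%:R -> lhs t = rhs t}.
  apply: filterS (ae_cross_correlation_cvg0 sb sr orth) => t St t0.
  (* The integers removed from [A0] are covered by the pointwise identity. *)
  have [[k _ <-]|nt] := pselect (@nat_upto R m t); first exact: (eqint k%:Z).
  by apply/eqS/St; split => //=; rewrite in_itv.
split=> // t t0 [[n ->]//|[lc rc]].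
exact: ae_eq_continuous ae t0 lc rc.
Qed.
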